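(* Let $d\in\mathbb N$ and let $Q=(q_{i,j})_{i,j=1,\dots,d}$ be a symmetric matrix with $q_{i,j}\in\{0,1\}$ for $i\neq j$ and $q_{i,i}=0$ for all $i$. For $n=d^2m$ with $m\in\mathbb N$, let $B_{i,j,n}=\{(i-1)dm+(j-1)m+k\mid k=1,\dots,m\}$ for $i,j=1,\dots,d$, let $A'_{i,n}=\bigcup_{j:\,q_{i,j}=0}(B_{i,j,n}\cup B_{j,i,n})$, for each $k=1,\dots,d$ take $A''_{k,n}\subset\{kn+1,kn+2,\dots,(k+1)n\}$ with $|A''_{k,n}|=n-|A'_{k,n}|$, and let $A_{k,n}=A'_{k,n}\cup A''_{k,n}$ (so that $|A_{k,n}|=n$). Let $r_{k,n}=2\lfloor n^{2/3}/4\rfloor$ and $$H_{k,n}=\frac{(\sqrt{-1})^{\lfloor r_{k,n}/2\rfloor}}{\binom{n}{r_{k,n}}^{1/2}}\sum_{\substack{i_1<\cdots<i_{r_{k,n}}\\ i_1,\dots,i_{r_{k,n}}\in A_{k,n}}}J_{k;i_1,\dots,i_{r_{k,n}}}\psi_{i_1}\cdots\psi_{i_{r_{k,n}}},$$ where the $J_{k;i_1,\dots,i_{r_{k,n}}}$ are independent standard Gaussian random variables and the $\psi_i$ are Majorana fermions satisfying the canonical anticommutation relations $\psi_i\psi_j+\psi_j\psi_i=2\delta_{i,j}$. Then, as $n=d^2m\to\infty$, $\{H_{k,n}\mid k=1,\dots,d\}$ converges in distribution to the mixed $q$-Gaussian system $\{s_k\mid k=1,\dots,d\}$ with $q$-relation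 $Q$; that is, for all $p\in\mathbb N$ and $k_1,\dots,k_p\in\{1,\dots,d\}$, $$\lim_{m\to\infty}\mathbb E\left[\operatorname{tr}(H_{k_1,n}\cdots H_{k_p,n})\right]=\tau_{\mathcal H}(s_{k_1}\cdots s_{k_p}),\qquad n=d^2m.$$
   Context: $\mathbb N=\{1,2,\dots\}$. Majorana fermions are self-adjoint elements $\psi_i$ ($i\in\mathbb N$) of a unital $*$-algebra (they can be chosen from an infinite-dimensional CAR algebra) with $\psi_i\psi_j+\psi_j\psi_i=2\delta_{i,j}$; $\operatorname{tr}$ is the normalized trace on the algebra they generate (so $\operatorname{tr}(1)=1$ and $\operatorname{tr}(\psi_{i_1}\cdots\psi_{i_r})=0$ for $i_1<\cdots<i_r$, $r\ge1$). Mixed $q$-Gaussian system: let $\mathcal H$ be a Hilbert space with orthonormal basis $e_1,\dots,e_d$, and let $\mathcal F_{\mathrm{alg}}(\mathcal H)$ be the algebraic full Fock space spanned by the vacuum $\Omega$ and the tensors $e_{j_1}\otimes\cdots\otimes e_{j_n}$, $n\ge1$. It carries the positive semidefinite form $\langle\cdot,\cdot\rangle_Q$ for which $\Omega$ is a unit vector, tensors of different lengths are orthogonal, and $$\langle e_{i_1}\otimes\cdots\otimes e_{i_n},e_{j_1}\otimes\cdots\otimes e_{j_n}\rangle_Q=\sum_{k=1}^n\delta_{i_1,j_k}q_{i_1,j_1}\cdots q_{i_1,j_{k-1}}\langle e_{i_2}\otimes\cdots\otimes e_{i_n},e_{j_1}\otimes\cdots\otimes e_{j_{k-1}}\otimes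 e_{j_{k+1}}\otimes\cdots\otimes e_{j_n}\rangle_Q .$$ The left creation and annihilation operators are $l_i\Omega=e_i$, $l_i(e_{j_1}\otimes\cdots\otimes e_{j_n})=e_i\otimes e_{j_1}\otimes\cdots\otimes e_{j_n}$; $l_i^*\Omega=0$, $l_i^*(e_{j_1}\otimes\cdots\otimes e_{j_n})=\sum_{k=1}^n\delta_{i,j_k}q_{i,j_1}\cdots q_{i,j_{k-1}}e_{j_1}\otimes\cdots\otimes e_{j_{k-1}}\otimes e_{j_{k+1}}\otimes\cdots\otimes e_{j_n}$. Put $s_i=l_i+l_i^*$ and $\tau_{\mathcal H}(a)=\langle a\Omega,\Omega\rangle_Q$. *)

(* Defs.v *)
From HB Require Import structures.
From mathcomp Require Import all_boot all_order all_algebra.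
From mathcomp Require Import finmap complex.
(* The notations of [monalg] and of MathComp-Analysis cannot be loaded
   together. *)
From mathcomp Require Import -(notations) monalg.
From mathcomp Require Import all_classical all_reals all_analysis.

Set Implicit Arguments.
Unset Strict Implicit.
Unset Printing Implicit Defensive.
Import Order.TTheory GRing.Theory Num.Theory.

Local Open Scope classical_set_scope.
Local Open Scope complex_scope.
Local Open Scope ring_scope.

(** ** Probability *)

(* Finite subfamilies of the family [X] restricted to the index set [D] are
   enumerated by duplicate-free sequences. *)
Definition mutually_independent (R : realType) (disp : measure_display)
    (T : measurableType disp) (P : probability T R) (I : eqType)
    (D : set I) (X : I -> {RV P >-> R}) : Prop :=
  forall (s : seq I) (B : I -> set R),
    uniq s -> (forall i, i \in s -> D i) ->
    (forall i, i \in s -> measurable (B i)) ->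
    P (\bigcap_(i in [set` s]) (X i @^-1` B i)) =
    (\prod_(i <- s) P (X i @^-1` B i))%E.

Definition standard_gaussian (R : realType) (disp : measure_display)
    (T : measurableType disp) (P : probability T R) (X : {RV P >-> R}) : Prop :=
  forall B : set R, measurable B -> distribution P X B = normal_prob 0 1 B.

Definition complex_integrable (R : realType) (disp : measure_display)
    (T : measurableType disp) (P : probability T R) (Z : T -> R[i]) : Prop :=
  P.-integrable setT (fun w => (complex.Re (Z w))%:E) /\
  P.-integrable setT (fun w => (complex.Im (Z w))%:E).

Definition complex_expectation (R : realType) (disp : measure_display)
    (T : measurableType disp) (P : probability T R) (Z : T -> R[i]) : R[i] :=
  fine 'E_P[fun w => complex.Re (Z w)] +i* fine 'E_P[fun w => complex.Im (Z w)].

(** ** Majorana fermions *)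

Record star_operation (R : realType) (A : algType R[i]) (star : A -> A) : Prop :=
  StarOperation {
    star_antilinear : forall (a : R[i]) (x y : A),
      star (a *: x + y) = a^* *: star x + star y;
    star_mul : forall x y : A, star (x * y) = star y * star x;
    star_involutive : involutive star
  }.

(* The fermions are indexed by the positive integers; [psi 0] is unconstrained
   and never used. *)
Record majorana_fermions (R : realType) (A : algType R[i]) (star : A -> A)
    (psi : nat -> A) : Prop :=
  MajoranaFermions {
    majorana_selfadjoint : forall i : nat, (0 < i)%N -> star (psi i) = psi i;
    majorana_CAR : forall i j : nat, (0 < i)%N -> (0 < j)%N ->
      psi i * psi j + psi j * psi i = 2 * (i == j)%:R
  }.

(* The unital algebra generated by the [psi i], [i >= 1]; it is closed under
   the star operation because its generators are self-adjoint. *)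
Inductive majorana_algebra (R : realType) (A : algType R[i]) (psi : nat -> A) :
    A -> Prop :=
| majorana_gen (i : nat) of (0 < i)%N : majorana_algebra psi (psi i)
| majorana_one : majorana_algebra psi 1
| majorana_lin (a : R[i]) (x y : A) of
    majorana_algebra psi x & majorana_algebra psi y :
    majorana_algebra psi (a *: x + y)
| majorana_mul (x y : A) of
    majorana_algebra psi x & majorana_algebra psi y :
    majorana_algebra psi (x * y).

(* By the anticommutation relations these axioms determine [tr] on the algebra
   generated by the fermions: a monomial [psi i_1 * ... * psi i_r] with
   [i_1 < ... < i_r] and [r >= 1] has trace 0.  Nothing is required of the
   values of [tr] outside that algebra. *)
Record normalized_trace (R : realType) (A : algType R[i]) (psi : nat -> A)
    (tr : A -> R[i]) : Prop :=
  NormalizedTrace {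
    trace_linear : forall (a : R[i]) (x y : A),
      majorana_algebra psi x -> majorana_algebra psi y ->
      tr (a *: x + y) = a * tr x + tr y;
    trace_tracial : forall x y : A,
      majorana_algebra psi x -> majorana_algebra psi y ->
      tr (x * y) = tr (y * x);
    trace_one : tr 1 = 1
  }.

(** ** Index sets *)

(* The indices [i, j, k : 'I_d] stand for the integers [i.+1], [j.+1], [k.+1]
   of {1, ..., d}; the elements of the sets below are the indices of the
   fermions and are not shifted. *)

Definition sys_size (d m : nat) : nat := (d ^ 2 * m)%N.

Definition block (d m : nat) (i j : 'I_d) : {fset nat} :=
  [fset x in iota (i * (d * m) + j * m).+1 m]%fset.

Definition shared_indices (R : realType) (d : nat) (Q : 'M[R]_d) (m : nat)
    (i : 'I_d) : {fset nat} :=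
  (\bigcup_(j | Q i j == 0%R) (block m i j `|` block m j i))%fset.

Definition private_range (d m : nat) (k : 'I_d) : {fset nat} :=
  [fset x in iota (k.+1 * sys_size d m).+1 (sys_size d m)]%fset.

Definition private_choice (R : realType) (d : nat) (Q : 'M[R]_d)
    (A2 : nat -> 'I_d -> {fset nat}) : Prop :=
  forall (m : nat) (k : 'I_d), (0 < m)%N ->
    (A2 m k `<=` private_range m k)%fset /\
    (#|` A2 m k| = sys_size d m - #|` shared_indices Q m k|)%N.

Definition model_indices (R : realType) (d : nat) (Q : 'M[R]_d)
    (A2 : nat -> 'I_d -> {fset nat}) (m : nat) (k : 'I_d) : {fset nat} :=
  (shared_indices Q m k `|` A2 m k)%fset.

(** ** The random Hamiltonians *)

(* On a nonnegative argument [Num.truncn] is the floor. *)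
Definition interaction_length (R : realType) (n : nat) : nat :=
  (2 * Num.truncn ((n%:R : R) `^ (2 / 3) / 4)%R)%N.

(* [J k [:: i_1; ...; i_r]] is the coefficient J_{k; i_1, ..., i_r}. *)
Definition SYK_hamiltonian (R : realType) (d : nat) (Q : 'M[R]_d)
    (A : algType R[i]) (psi : nat -> A) (T : Type)
    (J : 'I_d -> seq nat -> T -> R) (A2 : nat -> 'I_d -> {fset nat})
    (m : nat) (k : 'I_d) (w : T) : A :=
  let n := sys_size d m in
  let r := interaction_length R n in
  ('i ^+ r./2 / (Num.sqrt 'C(n, r)%:R)%:C) *:
  \sum_(t : r.-tuple (model_indices Q A2 m k) | sorted ltn (map val t))
     (J k (map val t) w)%:C *: \prod_(i <- map val t) psi i.

(* The pairs [(k, [:: i_1; ...; i_r])] with [1 <= i_1 < ... < i_r]. *)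
Definition coupling_index (d : nat) : set ('I_d * seq nat) :=
  [set kt | path ltn 0%N kt.2].

(** ** The mixed q-Gaussian system *)

(* The algebraic full Fock space over a [d]-dimensional space is the complex
   vector space with basis the words in ['I_d]: the word [:: j_1; ...; j_n] is
   the tensor e_{j_1} (x) ... (x) e_{j_n}, and the empty word is the vacuum. *)
Notation fock R d := (malg (seq 'I_d) R[i]).

Definition fock_word (R : realType) (d : nat) (u : seq 'I_d) : fock R d :=
  mkmalgU u 1.

Definition vacuum (R : realType) (d : nat) : fock R d := fock_word R [::].

Definition fock_extend (R : realType) (d : nat) (f : seq 'I_d -> fock R d)
    (x : fock R d) : fock R d :=
  \sum_(u <- msupp x) mcoeff u x *: f u.

Arguments fock_word : simpl never.
Arguments fock_extend : simpl never.

Definition remove_at (I : Type) (v : seq I) (k : nat) : seq I :=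
  take k v ++ drop k.+1 v.

(* Words of different lengths come out orthogonal: the recursion ends on an
   empty and a nonempty word. *)
Fixpoint word_form (R : realType) (d : nat) (Q : 'M[R]_d) (u v : seq 'I_d) : R :=
  match u, v with
  | [::], [::] => 1
  | [::], _ :: _ => 0
  | i :: u', _ =>
      \sum_(k < size v | tnth (in_tuple v) k == i)
         (\prod_(j <- take k v) Q i j) * word_form Q u' (remove_at v k)
  end.

(* Linear in the first argument, antilinear in the second. *)
Definition fock_form (R : realType) (d : nat) (Q : 'M[R]_d) (x y : fock R d) :
    R[i] :=
  \sum_(u <- msupp x) \sum_(v <- msupp y)
     mcoeff u x * (mcoeff v y)^* * (word_form Q u v)%:C.

Definition creation (R : realType) (d : nat) (i : 'I_d) : fock R d -> fock R d :=
  fock_extend (fun v => fock_word R (i :: v)).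

Definition annihilation (R : realType) (d : nat) (Q : 'M[R]_d) (i : 'I_d) :
    fock R d -> fock R d :=
  fock_extend (fun v =>
    \sum_(k < size v | tnth (in_tuple v) k == i)
       (\prod_(j <- take k v) Q i j)%:C *: fock_word R (remove_at v k)).

Definition q_gaussian (R : realType) (d : nat) (Q : 'M[R]_d) (i : 'I_d)
    (x : fock R d) : fock R d :=
  creation i x + annihilation Q i x.

Definition operator_product (V : Type) (s : seq (V -> V)) : V -> V :=
  foldr (fun a b => a \o b) id s.

Definition vacuum_state (R : realType) (d : nat) (Q : 'M[R]_d)
    (a : fock R d -> fock R d) : R[i] :=
  fock_form Q (a (vacuum R d)) (vacuum R d).

(* Main.v *)
Require Import Defs.
From HB Require Import structures.
From mathcomp Require Import all_boot all_order all_algebra.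
From mathcomp Require Import finmap complex.
From mathcomp Require Import -(notations) monalg.
From mathcomp Require Import all_classical all_reals all_analysis.
From mathcomp Require Import measurable_realfun.
From mathcomp Require Import zify ring lra.
Import Order.TTheory GRing.Theory Num.Theory.
Import numFieldNormedType.Exports.
Local Open Scope classical_set_scope.
Local Open Scope ring_scope.

Set Implicit Arguments.
Unset Strict Implicit.
Unset Printing Implicit Defensive.

(** Write a Hamiltonian as a sum of Gaussian couplings times self-inverse
    monomials [monomial m (k, t)], one for each label [t], that is, each set of
    r sites available to the colour k.  Expanding the product of Hamiltonians,
    each word of labels contributes the expectation of its couplings times the
    trace of its monomials.  The Wick formula ([wick_moments]) turns the first
    factor into the number of complete contractions of equal letters; in the
    algebra, bringing two equal letters together costs one sign (-1)^|S :&: T| for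
    each letter crossed on the way, and the contracted pair is 1
    ([amplitude_word]).  Both the number of contractions and its signed version
    satisfy the recursion that computes the vacuum moments of the q-Gaussian
    system, with 1 or with these signs in place of the numbers q
    ([amplitude], [vacuum_state_amplitude]).  Hence the expected trace is exactly
    the q-Gaussian recursion in which the numbers q_ij are replaced by the signs
    of random labels and the result is averaged over the labels ([mean_trace]).

    It remains to replace the random sign of a crossing by q_ij
    ([mean_amplitude_cvg]).  If q_ij = 1, the two colours have disjoint sites and
    the sign is 1.  If q_ij = 0, they share at least m = n/d^2 sites, so that two
    random labels meet in about n^(1/3) sites and the sign averages out.  A
    contracted letter no longer occurs in the rest of the recursion, so it is
    enough that its average sign against the crossed letters is small in mean.
    By the Cauchy-Schwarz inequality this reduces to the average sign of one random
    r-subset against the symmetric difference of two others ([crossing_bound]).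
    That average is a Krawtchouk polynomial, bounded by comparing coefficients
    in (1-X^2)^x (1+X)^(n-2x) ([krawtchouk_bound]); comparing r-subsets with
    independent sites then gives the bound (n+1)^3 (1 - (r/n)^2)^m, up to
    constants, where m (r/n)^2 is of order n^(1/3) ([overlap_bound],
    [crossing_error_le]). *)

(** * Contractions of words *)

Section amplitude.
Variables (R : comNzRingType) (X : eqType) (w : X -> X -> R).

(** The coefficient of the empty word when the letters of [a], from the first to
    the last, act on the word [v] by creation plus annihilation, with [w] in place
    of the numbers q.  Products of operators act from the right, so [a] is such a
    product read backwards. *)
Fixpoint amplitude (a v : seq X) : R :=
  match a with
  | [::] => (v == [::])%:R
  | x :: a' => amplitude a' (x :: v) +
      \sum_(k < size v | tnth (in_tuple v) k == x)
         (\prod_(y <- take k v) w x y) * amplitude a' (remove_at v k)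
  end.
End amplitude.

Section positions.
Variable X : eqType.
Implicit Types v : seq X.

Lemma split_at v (k : 'I_(size v)) :
  v = take k v ++ tnth (in_tuple v) k :: drop k.+1 v.
Proof.
case: v k => [|x0 v] k; first by case: k.
by rewrite (tnth_nth x0)/= -drop_nth ?cat_take_drop// ltn_ord.
Qed.

Lemma perm_remove_at v (k : 'I_(size v)) :
  perm_eq v (tnth (in_tuple v) k :: remove_at v k).
Proof. by rewrite {1}(split_at k) /remove_at -cat1s perm_catCA. Qed.

Lemma count_tnth x v : #|[pred k : 'I_(size v) | tnth (in_tuple v) k == x]| =
  count_mem x v.
Proof.
by rewrite -sum1_card -sum1_count [RHS]big_tnth.
Qed.

Lemma size_remove_at v (k : 'I_(size v)) : size (remove_at v k) = (size v).-1.
Proof. exact: esym (congr1 predn (perm_size (perm_remove_at k))). Qed.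
End positions.

(** * Vacuum moments of the mixed q-Gaussian system *)

Section vacuum_moments.
Variables (R : realType) (d : nat) (Q : 'M[R]_d).
Local Notation fock := (fock R d).
Implicit Types (x y : fock) (v : seq 'I_d) (ks : seq 'I_d).

Lemma fock_extend_sub (f : seq 'I_d -> fock) (E : {fset seq 'I_d}) x :
  (msupp x `<=` E)%fset ->
  fock_extend f x = \sum_(u <- E) mcoeff u x *: f u.
Proof.
move=> xE; rewrite /fock_extend; apply: big_fset_incl => // u uE ux.
by rewrite mcoeff_outdom// scale0r.
Qed.

Lemma fock_extend_linear (f : seq 'I_d -> fock) a x y :
  fock_extend f (a *: x + y) = a *: fock_extend f x + fock_extend f y.
Proof.
pose E := (msupp (a *: x + y) `|` (msupp x `|` msupp y))%fset.
rewrite (@fock_extend_sub _ E); last exact: fsubsetUl.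
rewrite [fock_extend f x](@fock_extend_sub _ E); last first.
  by rewrite /E fsetUCA fsubsetUl.
rewrite [fock_extend f y](@fock_extend_sub _ E); last first.
  by rewrite /E fsetUA fsubsetUr.
rewrite scaler_sumr -big_split/=; apply: eq_bigr => u _.
by rewrite mcoeffD mcoeffZ scalerDl scalerA.
Qed.

Lemma fock_extend_word (f : seq 'I_d -> fock) v : fock_extend f (fock_word R v) = f v.
Proof.
rewrite (@fock_extend_sub _ [fset v]%fset); last exact: msuppU_le.
by rewrite big_seq_fset1 mcoeffUU scale1r.
Qed.

Lemma q_gaussian_linear i a x y :
  q_gaussian Q i (a *: x + y) = a *: q_gaussian Q i x + q_gaussian Q i y.
Proof.
rewrite /q_gaussian /creation /annihilation !fock_extend_linear scalerDr.
by rewrite addrACA.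
Qed.

Definition q_gaussian_word ks : fock -> fock :=
  operator_product [seq q_gaussian Q k | k <- ks].

Lemma q_gaussian_word_cons k ks x :
  q_gaussian_word (k :: ks) x = q_gaussian Q k (q_gaussian_word ks x).
Proof. by []. Qed.

Lemma q_gaussian_word_rcons ks i x :
  q_gaussian_word (rcons ks i) x = q_gaussian_word ks (q_gaussian Q i x).
Proof.
elim: ks => [|k ks IH]; first by rewrite /q_gaussian_word/=.
by rewrite rcons_cons !q_gaussian_word_cons IH.
Qed.

Lemma q_gaussian_word_linear ks a x y :
  q_gaussian_word ks (a *: x + y) = a *: q_gaussian_word ks x + q_gaussian_word ks y.
Proof.
by elim: ks => //= k ks; rewrite /q_gaussian_word/= => ->; exact: q_gaussian_linear.
Qed.

HB.instance Definition _ ks :=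
  GRing.isLinear.Build R[i] fock fock _ (q_gaussian_word ks) (q_gaussian_word_linear ks).

(** The rightmost operator acts first: its creation part adds a letter to [v] and
    its annihilation part removes one, as in the recursion for [amplitude]. *)
Lemma mcoeff_q_gaussian_word ks v :
  mcoeff [::] (q_gaussian_word ks (fock_word R v)) = (amplitude Q (rev ks) v)%:C%C.
Proof.
elim/last_ind: ks v => [|ks i IH] v.
  by rewrite /= /q_gaussian_word/= /fock_word mcoeffU; case: eqP.
rewrite q_gaussian_word_rcons rev_rcons /= /q_gaussian /creation /annihilation.
rewrite !fock_extend_word !linearD/= mcoeffD IH raddfD/=; congr (_ + _).
rewrite linear_sum/= raddf_sum/= [RHS]rmorph_sum/=; apply: eq_bigr => k _.
by rewrite linearZ/= mcoeffZ IH rmorphM.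
Qed.

(** The vacuum is orthogonal to all nonempty words. *)
Lemma vacuum_state_coeff (a : fock -> fock) :
  vacuum_state Q a = mcoeff [::] (a (vacuum R d)).
Proof.
rewrite /vacuum_state /fock_form.
have -> : msupp (vacuum R d) = [fset [::]]%fset by rewrite /vacuum /fock_word msuppU oner_eq0.
under eq_bigr => u _ do rewrite big_seq_fset1 mcoeffUU rmorph1 mulr1.
set x := a _.
have wf u : (word_form Q u [::])%:C%C = (u == [::])%:R :> R[i].
  by case: u => //= i u; rewrite big_ord0.
have [x0|x0] := boolP ([::] \in msupp x); last first.
  rewrite (mcoeff_outdom x0) big_seq big1// => u ux.
  by rewrite wf; case: eqP => [u0|]; rewrite ?mulr0//; rewrite -u0 ux in x0.
rewrite (bigD1_seq [::] x0 (fset_uniq _))/= mulr1 big1 ?addr0// => u /negPf u0.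
by rewrite wf u0 mulr0.
Qed.

Lemma vacuum_state_amplitude ks :
  vacuum_state Q (operator_product [seq q_gaussian Q k | k <- ks]) =
  (amplitude Q (rev ks) [::])%:C%C.
Proof. by rewrite vacuum_state_coeff -mcoeff_q_gaussian_word. Qed.
End vacuum_moments.

(** * Gaussian moments and the Wick formula *)

Section change_of_measure.
Local Open Scope ereal_scope.
Import HBNNSimple.

(** Two instances are needed: [X] the identity and [g] a density, and [X] a random
    variable with [g] a function of variables independent of it. *)
Lemma ge0_integral_density d d' (T : measurableType d) (Y : measurableType d')
    (R : realType) (mu : {measure set T -> \bar R})
    (nu : {measure set Y -> \bar R}) (g : T -> R) (X : T -> Y)
    (f : Y -> R) :
  measurable_fun [set: T] g -> (forall x, (0 <= g x)%R) ->
  measurable_fun [set: T] X ->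
  (forall B, measurable B -> \int[mu]_(x in X @^-1` B) (g x)%:E = nu B) ->
  measurable_fun [set: Y] f -> (forall y, (0 <= f y)%R) ->
  \int[mu]_x (f (X x) * g x)%:E = \int[nu]_y (f y)%:E.
Proof.
move=> mg g0 mX gnu mf f0.
have mfE : measurable_fun [set: Y] (EFin \o f) by exact/measurable_EFinP.
pose h := nnsfun_approx measurableT mfE.
have hf y : (h n y)%:E @[n --> \oo] --> (f y)%:E.
  by apply: (cvg_nnsfun_approx measurableT mfE) => // *; rewrite /= lee_fin.
have ndh y : {homo (fun n => h n y) : m n / (m <= n)%N >-> (m <= n)%R}.
  by move=> m n mn; exact/lefP/nd_nnsfun_approx.
have mhX n : measurable_fun [set: T] (fun x => h n (X x)).
  by apply: measurableT_comp => //; exact: measurable_funP.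
have mgE : measurable_fun [set: T] (EFin \o g) by exact/measurable_EFinP.
have -> : \int[nu]_y (f y)%:E = limn (fun n => \int[nu]_y (h n y)%:E).
  rewrite -monotone_convergence//.
  - by apply: eq_integral => y _; apply/esym/cvg_lim.
  - by move=> n; exact/measurable_EFinP/measurable_funP.
  - by move=> n y _; rewrite lee_fin.
  - by move=> y _ m n mn; rewrite lee_fin; exact: ndh.
transitivity (limn (fun n => \int[mu]_x (h n (X x) * g x)%:E)).
  rewrite -monotone_convergence//.
  - apply: eq_integral => x _; apply/esym/cvg_lim => //.
    under eq_fun do rewrite EFinM.
    by rewrite EFinM; apply: cvgeZr.
  - by move=> n; apply/measurable_EFinP; apply: measurable_funM.
  - by move=> n x _; rewrite lee_fin mulr_ge0.
  - by move=> x _ m n mn; rewrite lee_fin ler_wpM2r//; exact: ndh.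
congr (limn _); apply/funext => n.
transitivity (\int[nu]_y
   (\sum_(r \in range (h n)) (r * \1_(h n @^-1` [set r]) y)%:E)); last first.
  by apply: eq_integral => t _; rewrite /= [in RHS]fimfunE -fsumEFin.
have indich r : measurable_fun [set: Y]
    (fun x => (r * \1_(h n @^-1` [set r]) x)%:E).
  by apply/measurable_EFinP; exact: measurable_funM.
rewrite ge0_integral_fsum//; last by move=> r y _; exact: nnfun_muleindic_ge0.
transitivity (\int[mu]_x (\sum_(r \in range (h n))
    (r * \1_(h n @^-1` [set r]) (X x))%:E * (g x)%:E)).
  apply: eq_integral => x _.
  rewrite -ge0_mule_fsuml => [|y]; last exact: nnfun_muleindic_ge0.
  by rewrite fsumEFin // -(fimfunE _ (X x)).
have mX' r : measurable (X @^-1` (h n @^-1` [set r])).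
  by rewrite -[X in measurable X]setTI; apply: mX => //; exact: measurable_sfunP.
rewrite ge0_integral_fsum//; last 2 first.
  - move=> r; apply: emeasurable_funM => //.
    exact: (measurableT_comp (indich r) mX).
  - by move=> r x _; apply: mule_ge0; [exact: nnfun_muleindic_ge0|rewrite lee_fin].
apply: eq_fsbigr => r rhn.
under [RHS]eq_integral do rewrite EFinM.
rewrite integralZl_indic_nnsfun => //.
under eq_integral do rewrite EFinM -muleA.
have g1 : measurable_fun [set: T]
    (fun x => (\1_(h n @^-1` [set r]) (X x))%:E * (g x)%:E).
  by apply: emeasurable_funM => //; apply/measurable_EFinP;
     apply: (measurableT_comp _ mX).
have r0 : 0 <= r%:E by move: rhn; rewrite inE => -[y _ <-]; rewrite lee_fin.
rewrite ge0_integralZl//; last by move=> x _; rewrite mule_ge0 ?lee_fin.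
rewrite integral_indic// setIT -gnu//.
congr *%E; rewrite [RHS]integral_mkcond; apply: eq_integral => x _.
by rewrite epatch_indic/= muleC.
Qed.
End change_of_measure.

Section gaussian_integration_by_parts.
Variable R : realType.
Implicit Types (p : {poly R}) (x : R).
Local Notation mu := (@lebesgue_measure R).
Local Notation phi := (normal_pdf 0 1 : R -> R).

Let phiE x : phi x = normal_peak 1 * expR (- (x ^+ 2 / 2)).
Proof.
by rewrite normal_pdfE ?oner_neq0// /normal_fun subr0 expr1n mulNr mulr2n.
Qed.

(** A power of x^2/4 is bounded by a term of the exponential series; odd powers
    are handled through t <= 1 + t^2. *)
Lemma expr_le_expR_sqr i x :
  `|x| ^+ i <= (1 + 4 ^+ i * i`!%:R) * expR (x ^+ 2 / 4).
Proof.
have y0 : 0 <= x ^+ 2 / 4 by rewrite divr_ge0 ?sqr_ge0.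
have e1 : 1 <= expR (x ^+ 2 / 4) by rewrite (le_trans _ (expR_ge1Dx _))// lerDl.
apply: (@le_trans _ _ (1 + (x ^+ 2) ^+ i)).
  have -> : (x ^+ 2) ^+ i = (`|x| ^+ i) ^+ 2.
    by rewrite -normrX real_normK ?num_real// -!exprM mulnC.
  have := exprn_ge0 i (normr_ge0 x); move: (`|x| ^+ i) => t; nra.
have : (x ^+ 2 / 4) ^+ i <= i`!%:R * expR (x ^+ 2 / 4).
  case: i => [|i]; first by rewrite expr0 fact0 mul1r.
  have := expR_ge1Dxn i y0.
  rewrite addrC -lerBrDr ler_pdivrMr ?ltr0n ?fact_gt0// => /le_trans; apply.
  by rewrite mulrC ler_wpM2l// gerBl.
rewrite expr_div_n ler_pdivrMr ?exprn_gt0// => h.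
rewrite mulrDl mul1r lerD// (le_trans h)//.
by rewrite mulrC mulrA.
Qed.

Lemma horner_le_expR_sqr p : exists2 C, 0 <= C &
  forall x, `|p.[x]| <= C * expR (x ^+ 2 / 4).
Proof.
exists (\sum_(i < size p) `|p`_i| * (1 + 4 ^+ i * i`!%:R)).
  by apply: sumr_ge0 => i _; rewrite mulr_ge0// addr_ge0// mulr_ge0// exprn_ge0.
move=> x; rewrite horner_coef (le_trans (ler_norm_sum _ _ _))// mulr_suml.
apply: ler_sum => i _; rewrite normrM normrX -mulrA ler_wpM2l//.
exact: expr_le_expR_sqr.
Qed.

(** Half of the Gaussian exponent absorbs the polynomial; the other half gives
    both integrability and decay at infinity. *)
Lemma horner_pdf_le p : exists2 C, 0 <= C &
  forall x, `|p.[x] * phi x| <= C * expR (- (x ^+ 2 / 4)).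
Proof.
have [C C0 hC] := horner_le_expR_sqr p.
exists (C * normal_peak 1); first by rewrite mulr_ge0// normal_peak_ge0.
move=> x; rewrite phiE normrM [X in _ * X]ger0_norm; last first.
  by rewrite mulr_ge0 ?normal_peak_ge0 ?expR_ge0.
apply: (le_trans (ler_wpM2r _ (hC x))).
  by rewrite mulr_ge0 ?normal_peak_ge0 ?expR_ge0.
rewrite mulrACA -!mulrA ler_wpM2l// ler_wpM2l ?normal_peak_ge0//.
by rewrite -expRD ler_expR; lra.
Qed.

Lemma measurable_horner_pdf p : measurable_fun [set: R] (fun x => p.[x] * phi x).
Proof.
by apply: measurable_funM; [exact: measurable_poly|exact: measurable_normal_pdf].
Qed.

Lemma integrable_expR_sqr (C : R) :
  mu.-integrable [set: R] (fun x => (C * expR (- (x ^+ 2 / 4)))%:E).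
Proof.
have s0 : Num.sqrt 2 != 0 :> R by rewrite sqrtr_eq0 -ltNge.
have -> : (fun x : R => (C * expR (- (x ^+ 2 / 4)))%:E) =
  (fun x => (C / normal_peak (Num.sqrt 2))%:E * (normal_pdf 0 (Num.sqrt 2) x)%:E)%E.
  apply/funext => x; rewrite -EFinM normal_pdfE// /normal_fun subr0.
  rewrite sqr_sqrtr// mulrA divfK ?gt_eqF ?normal_peak_gt0//.
  congr ((_ * expR _)%:E); rewrite mulNr; congr (- (_ / _)).
  by rewrite -mulrnA.
exact/integrableZl/integrable_normal_pdf.
Qed.

Lemma integrable_horner_pdf p :
  mu.-integrable [set: R] (fun x => (p.[x] * phi x)%:E).
Proof.
have [C C0 hC] := horner_pdf_le p.
apply: le_integrable (integrable_expR_sqr C) => //.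
  by apply/measurable_EFinP; exact: measurable_horner_pdf.
move=> x _; rewrite lee_fin (le_trans (hC x))//.
by rewrite ger0_norm// mulr_ge0 ?expR_ge0.
Qed.

(** The hypothesis on [e] means that [e] is 1 or -1. *)
Lemma cvg_horner_pdf p (e : R) : e ^+ 2 = 1 ->
  (p.[e * n%:R] * phi (e * n%:R)) @[n --> \oo] --> (0 : R).
Proof.
move=> e1; have [C C0 hC] := horner_pdf_le p.
have h : (C * expR (- (n%:R / 4))) @[n --> \oo] --> (0 : R).
  rewrite -[X in _ --> X](mulr0 C); apply: cvgMr.
  apply: (@cvg_comp _ _ _ (fun n => n%:R / 4) (fun x => expR (- x)) \oo +oo).
    apply: (cvg_comp _ (fun x => x / 4) cvgr_idn).
    by apply: gt0_cvgMly cvg_id; rewrite invr_gt0.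
  exact: cvgr_expR.
apply/norm_cvg0P.
apply: (squeeze_cvgr _ (cvg_cst 0) h).
apply: nearW => n; rewrite normr_ge0/= (le_trans (hC _))// ler_wpM2l// ler_expR.
rewrite lerN2 exprMn e1 mul1r ler_pM2r ?invr_gt0// -natrX ler_nat.
by case: n => // n; rewrite expnS expn1 leq_pmulr.
Qed.

Lemma is_derive_horner_pdf p x :
  is_derive x 1 (fun x => p.[x] * phi x) ((p^`() - 'X * p).[x] * phi x).
Proof.
have -> : (fun x => p.[x] * phi x) =
    horner p * (fun x => normal_peak 1 * expR (- (x ^+ 2 / 2))).
  by apply/funext => y; rewrite /= phiE.
have dphi : is_derive x 1 (fun x : R => normal_peak 1 * expR (- (x ^+ 2 / 2)))
    (- x * phi x).
  have d2 : is_derive x 1 (fun x : R => - (x ^+ 2 / 2)) (- x).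
    have -> : (fun x : R => - (x ^+ 2 / 2)) = horner (- 2^-1 *: 'X^2).
      by apply/funext => y; rewrite !hornerE/=; field.
    by apply: trigger_derive; rewrite derivZ derivXn !hornerE/=; field.
  have d3 : is_derive x 1 (fun x : R => expR (- (x ^+ 2 / 2)))
      (expR (- (x ^+ 2 / 2)) * - x).
    exact: (@is_derive1_comp _ expR).
  have -> : (fun x : R => normal_peak 1 * expR (- (x ^+ 2 / 2))) =
    normal_peak 1 *: (fun x : R => expR (- (x ^+ 2 / 2))) by [].
  apply: trigger_derive; rewrite phiE /GRing.scale/=; ring.
apply: trigger_derive; rewrite !hornerE /GRing.scale/= -phiE; ring.
Qed.


(** The integrand is the derivative of [p] times the density: its integral over
    [-n, n] is a difference of boundary values, which tends to 0, and dominated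
    convergence lets n go to infinity. *)
Lemma integral_derive_horner_pdf p :
  (\int[mu]_x ((p^`() - 'X * p).[x] * phi x)%:E = 0)%E.
Proof.
set q := p^`() - 'X * p.
have cq (r : {poly R}) x : {for x, continuous (fun x => r.[x] * phi x)}.
  apply: cvgM; first exact: continuous_horner.
  exact: (continuous_normal_pdf (m := 0) (oner_neq0 R)).
pose I (n : nat) : set R := [set` `[- n%:R, n%:R]].
have FTC (n : nat) : (0 < n)%N ->
    (\int[mu]_(x in I n) (q.[x] * phi x)%:E =
     (p.[1 * n%:R] * phi (1 * n%:R) - p.[-1 * n%:R] * phi (-1 * n%:R))%:E)%E.
  move=> n0; rewrite mul1r mulN1r EFinB.
  apply: (@continuous_FTC2 _ _ (fun x => p.[x] * phi x)).
  - by rewrite gtrN// ltr0n.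
  - by apply: continuous_subspaceT => x; exact: cq.
  - split.
    + by move=> x _; have [] := is_derive_horner_pdf p x.
    + by apply: cvg_at_right_filter; exact: cq.
    + by apply: cvg_at_left_filter; exact: cq.
  - by move=> x _; rewrite derive1E; have [_ ->] := is_derive_horner_pdf p x.
have mq : measurable_fun [set: R] (fun x => (q.[x] * phi x)%:E).
  by apply/measurable_EFinP; exact: measurable_horner_pdf.
have mqn n : measurable_fun [set: R]
    (fun x => (q.[x] * phi x * \1_(I n) x)%:E).
  apply/measurable_EFinP; apply: measurable_funM; first exact: measurable_horner_pdf.
  by apply: measurable_indic; exact: measurable_itv.
have [] := @dominated_convergence _ _ R mu setT measurableT
  (fun n x => (q.[x] * phi x * \1_(I n) x)%:E)
  (fun x => (q.[x] * phi x)%:E) (fun x => `|(q.[x] * phi x)%:E|%E) mqn mq.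
- apply: aeW => x _; apply: cvg_near_cst.
  near=> n; rewrite indicE mem_set ?mulr1// /I/= in_itv/= -ler_norml.
  by near: n; exact: nbhs_infty_ger.
- by apply: integrable_abse; exact: integrable_horner_pdf.
- apply: aeW => x n _; rewrite lee_fin normrM ler_piMr// indicE.
  by case: (_ \in _); rewrite ?normr1 ?normr0.
move=> _ _ h.
rewrite -(cvg_lim _ h)//; apply: cvg_lim => //.
have -> : (0 = (0 - 0 : R)%:E)%E by rewrite subr0.
apply: (@cvg_trans _ ((p.[1 * n%:R] * phi (1 * n%:R) -
    p.[-1 * n%:R] * phi (-1 * n%:R))%:E @[n --> \oo])).
  apply: near_eq_cvg; near=> n; rewrite -FTC; last by near: n; exact: nbhs_infty_gt.
  rewrite /= integral_mkcond; apply: eq_integral => x _.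
  by rewrite EFinM epatch_indic.
apply: cvg_EFin; first by apply: nearW.
by apply: cvgB; apply: cvg_horner_pdf; rewrite ?sqrrN expr1n.
Unshelve. all: by end_near. Qed.

End gaussian_integration_by_parts.

Section gaussian_moments.
Variable R : realType.
Implicit Types (p q : {poly R}).
Local Notation mu := (@lebesgue_measure R).
Local Notation phi := (normal_pdf 0 1 : R -> R).
Local Notation gamma := (normal_prob (0 : R) 1).

Definition gaussian_mean p : R := fine (\int[mu]_x (p.[x] * phi x)%:E)%E.

Lemma gaussian_meanE p :
  (gaussian_mean p)%:E = (\int[mu]_x (p.[x] * phi x)%:E)%E.
Proof.
by rewrite fineK//; apply: integrable_fin_num => //; exact: integrable_horner_pdf.
Qed.

Lemma gaussian_mean1 : gaussian_mean 1 = 1.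
Proof.
apply: EFin_inj; rewrite gaussian_meanE -[RHS](integral_normal_pdf (0 : R) 1).
by apply: eq_integral => x _; rewrite hornerE mul1r.
Qed.

Lemma gaussian_meanB p q :
  gaussian_mean (p - q) = gaussian_mean p - gaussian_mean q.
Proof.
apply: EFin_inj; rewrite EFinB !gaussian_meanE -integralB//;
  try exact: integrable_horner_pdf.
by apply: eq_integral => x _; rewrite !hornerE mulrBl.
Qed.

Lemma gaussian_meanZ c p : gaussian_mean (c *: p) = c * gaussian_mean p.
Proof.
apply: EFin_inj; rewrite EFinM !gaussian_meanE -integralZl//;
  try exact: integrable_horner_pdf.
by apply: eq_integral => x _; rewrite !hornerE -EFinM mulrA.
Qed.

Lemma gaussian_mean_by_parts p : gaussian_mean ('X * p) = gaussian_mean p^`().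
Proof.
apply/esym/eqP; rewrite -subr_eq0 -gaussian_meanB; apply/eqP/EFin_inj.
by rewrite gaussian_meanE integral_derive_horner_pdf.
Qed.

Lemma ge0_integral_gaussian p : (forall x, 0 <= p.[x]) ->
  (\int[gamma]_x (p.[x])%:E)%E = (gaussian_mean p)%:E.
Proof.
move=> p0; rewrite gaussian_meanE.
rewrite -(@ge0_integral_density _ _ _ _ _ mu gamma phi id)//.
- exact: measurable_normal_pdf.
- exact: normal_pdf_ge0.
- exact: measurable_poly.
Qed.
End gaussian_moments.

Section gaussian_mean_linear.
Variable R : realType.

Lemma gaussian_mean_linear : linear (@gaussian_mean R : {poly R} -> R^o).
Proof.
move=> a p q; rewrite -[q in LHS]opprK gaussian_meanB gaussian_meanZ.
by rewrite -[- q]scaleN1r gaussian_meanZ mulN1r opprK.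
Qed.

HB.instance Definition _ :=
  GRing.isLinear.Build R {poly R} R^o _ (@gaussian_mean R : {poly R} -> R^o)
    gaussian_mean_linear.
End gaussian_mean_linear.

Section independent_gaussians.
Variables (R : realType) (disp : measure_display) (T : measurableType disp).
Variables (P : probability T R) (I : choiceType) (D : set I) (X : I -> {RV P >-> R}).
Hypothesis X_indep : mutually_independent D X.
Hypothesis X_gauss : forall i, D i -> standard_gaussian (X i).
Implicit Types (l : seq (I * {poly R})) (p q : {poly R}).

(** A family of polynomials indexed by distinct variables is a list of pairs, so
    that a single factor can be replaced. *)
Definition poly_product l (w : T) : R := \prod_(z <- l) z.2.[X z.1 w].

Lemma measurable_poly_product l : measurable_fun [set: T] (poly_product l).
Proof.
apply: measurable_prod => z _.
by apply: measurableT_comp; [exact: measurable_poly|exact: measurable_funP].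
Qed.

Lemma poly_product_ge0 l w :
  (forall z, z \in l -> forall x, 0 <= z.2.[x]) -> 0 <= poly_product l w.
Proof. by move=> l0; rewrite /poly_product big_seq prodr_ge0// => z /l0. Qed.

Lemma gaussian_mean_ge0 p : (forall x, 0 <= p.[x]) -> 0 <= gaussian_mean p.
Proof.
move=> p0; rewrite -lee_fin -ge0_integral_gaussian//.
by apply: integral_ge0 => x _; rewrite lee_fin.
Qed.

Lemma measurable_cylinder (s : seq I) (B : I -> set R) :
  (forall i, i \in s -> measurable (B i)) ->
  measurable (\bigcap_(i in [set` s]) (X i @^-1` B i)).
Proof.
move=> mB; apply: fin_bigcap_measurable; first exact: finite_seq.
move=> i /= /mB mBi; rewrite -[X in measurable X]setTI.
exact: (measurable_funP (X i)).
Qed.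

(** Independence gives the case of indicators ([l] empty).  Polynomials are then
    introduced one at a time: when the other factors are fixed, both sides define
    proportional measures in the event for [X i], and nonnegative functions
    integrate alike against them. *)
Lemma ge0_integral_poly_product l (s : seq I) (B : I -> set R) :
  uniq (map fst l ++ s) -> (forall i, i \in map fst l ++ s -> D i) ->
  (forall z, z \in l -> forall x, 0 <= z.2.[x]) ->
  (forall i, i \in s -> measurable (B i)) ->
  (\int[P]_(w in \bigcap_(i in [set` s]) (X i @^-1` B i))
     (poly_product l w)%:E =
   (\prod_(z <- l) gaussian_mean z.2)%:E * \prod_(i <- s) P (X i @^-1` B i))%E.
Proof.
elim: l s B => [|[i p] l IH] s B.
  move=> us sD _ mB; rewrite big_nil mul1e -X_indep//.
  under eq_integral do rewrite /poly_product big_nil.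
  by rewrite integral_cst ?mul1e//; exact: measurable_cylinder.
rewrite /= => /andP[]; rewrite mem_cat negb_or => /andP[il is_] uls lsD l0 mB.
have Di : D i by apply: lsD; rewrite mem_head.
have l0' z : z \in l -> forall x, 0 <= z.2.[x].
  by move=> zl; apply: l0; rewrite inE zl orbT.
have p0 x : 0 <= p.[x] by apply: (l0 (i, p)); rewrite mem_head.
set S := \bigcap_(i in _) _.
have mS : measurable S by exact: measurable_cylinder.
have [c cE] : exists c : {nonneg R}, (c%:num)%:E =
    ((\prod_(z <- l) gaussian_mean z.2)%:E * \prod_(i <- s) P (X i @^-1` B i))%E.
  have fP : (\prod_(i <- s) P (X i @^-1` B i))%E \is a fin_num.
    rewrite -X_indep//; first exact: fin_num_measure.
      by move: uls; rewrite cat_uniq => /and3P[].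
    by move=> j js; apply: lsD; rewrite inE mem_cat js !orbT.
  have c0 : 0 <= (\prod_(z <- l) gaussian_mean z.2) *
                 fine (\prod_(i <- s) P (X i @^-1` B i))%E.
    apply: mulr_ge0; last by apply: fine_ge0; apply: prode_ge0 => j _ /=.
    by rewrite big_seq prodr_ge0// => z /l0'; exact: gaussian_mean_ge0.
  by exists (NngNum c0); rewrite /= EFinM fineK.
pose g w := poly_product l w * \1_S w.
transitivity (\int[P]_w (p.[X i w] * g w)%:E)%E.
  rewrite integral_mkcond; apply: eq_integral => w _.
  rewrite epatch_indic -EFinM /g mulrA; congr (_ * _)%:E.
  by rewrite /poly_product big_cons.
rewrite (@ge0_integral_density _ _ _ _ _ P (mscale c (normal_prob 0 1)) g (X i)
  (horner p))//.
- have mp : measurable_fun [set: R] (fun x => (p.[x])%:E).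
    by apply/measurable_EFinP; exact: measurable_poly.
  rewrite ge0_integral_mscale//; last by move=> x _; rewrite lee_fin.
  by rewrite cE big_cons ge0_integral_gaussian// EFinM muleC muleA.
- apply: measurable_funM; first exact: measurable_poly_product.
  exact: measurable_indic.
- by move=> w; rewrite mulr_ge0// poly_product_ge0.
- by move=> _ A mA; exact: (measurable_funP (X i)) mA.
- move=> A mA; have gA : normal_prob 0 1 A = P (X i @^-1` A) by rewrite -(X_gauss Di mA).
  rewrite /mscale -[X in (_ = _ * X)%E]/(normal_prob 0 1 A) gA.
  pose B' j := if j == i then A else B j.
  have BB' j : j \in s -> B' j = B j.
    by rewrite /B'; case: eqP => // -> ijs; rewrite ijs in is_.
  have := IH (i :: s) B'; rewrite big_cons /B' eqxx.
  under [X in (_ = _ * (_ * X))%E]eq_big_seq => j js do rewrite -/(B' j) BB'//.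
  rewrite muleCA -cE muleC => <-.
  + rewrite [LHS]integral_mkcond [RHS]integral_mkcond; apply: eq_integral => w _.
    rewrite /g !epatch_indic -!EFinM -mulrA; congr (_ * _)%:E.
    suff -> : \bigcap_(j in [set` i :: s])
        (X j @^-1` (if j == i then A else B j)) = S `&` X i @^-1` A.
      by rewrite indicI.
    rewrite bigcap_seq big_cons eqxx setIC -bigcap_seq; congr (_ `&` _).
    by apply: eq_bigcapr => j js; rewrite -/(B' j) BB'.
  + by rewrite uniq_catC/= mem_cat negb_or is_ il uniq_catC.
  + move=> j; rewrite mem_cat inE orbCA => jls; apply: lsD.
    by rewrite inE mem_cat.
  + exact: l0'.
  + by move=> j; rewrite inE; case: eqP => //= _; exact: mB.
- exact: measurable_poly.
Qed.


(** Signed factors are reduced to nonnegative ones by linearity in each of them;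
    [l2] collects the factors already treated. *)
Lemma expectation_poly_product l1 l2 :
  uniq (map fst (l1 ++ l2)) -> (forall i, i \in map fst (l1 ++ l2) -> D i) ->
  (forall z, z \in l2 -> forall x, 0 <= z.2.[x]) ->
  P.-integrable [set: T] (EFin \o poly_product (l1 ++ l2)) /\
  (\int[P]_w (poly_product (l1 ++ l2) w)%:E =
   (\prod_(z <- l1 ++ l2) gaussian_mean z.2)%:E)%E.
Proof.
elim: l1 l2 => [|[i p] l1 IH] l2 /=.
  move=> ul lD l0.
  have E : (\int[P]_w (poly_product l2 w)%:E =
      (\prod_(z <- l2) gaussian_mean z.2)%:E)%E.
    have := @ge0_integral_poly_product l2 [::] (fun=> setT).
    rewrite cats0 big_nil mule1 => <- //.
    by rewrite bigcap_seq big_nil.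
  split=> //; apply/integrableP; split.
    by apply/measurable_EFinP; exact: measurable_poly_product.
  rewrite (_ : (\int[P]_w _)%E = (\int[P]_w (poly_product l2 w)%:E)%E).
    by rewrite E ltry.
  by apply: eq_integral => w _ /=; rewrite ger0_norm// poly_product_ge0.
move=> /andP[il ul] lD l0.
(* Every polynomial is a difference of two nonnegative ones. *)
pose q1 := p ^+ 2 + p + 1; pose q2 := p ^+ 2 + 1.
have pE : p = q1 - q2 by rewrite /q1 /q2; ring.
have q10 x : 0 <= q1.[x] by rewrite !hornerE; nra.
have q20 x : 0 <= q2.[x] by rewrite !hornerE; nra.
have IHq q : (forall x, 0 <= q.[x]) ->
    P.-integrable [set: T] (EFin \o poly_product ((i, q) :: l1 ++ l2)) /\
    (\int[P]_w (poly_product ((i, q) :: l1 ++ l2) w)%:E =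
     (\prod_(z <- (i, q) :: l1 ++ l2) gaussian_mean z.2)%:E)%E.
  move=> q0; have pl : perm_eq ((i, q) :: l1 ++ l2) (l1 ++ (i, q) :: l2).
    by rewrite perm_sym perm_catC/= perm_cons perm_catC.
  have -> : poly_product ((i, q) :: l1 ++ l2) = poly_product (l1 ++ (i, q) :: l2).
    by apply/funext => w; apply: perm_big.
  rewrite [in X in _ /\ X](perm_big _ pl); apply: IH.
  - by rewrite -(perm_uniq (perm_map fst pl)) /= il.
  - by move=> j; rewrite -(perm_mem (perm_map fst pl)); exact: lD.
  - by move=> z; rewrite inE => /orP[/eqP ->|/l0].
have [i1 e1] := IHq _ q10; have [i2 e2] := IHq _ q20.
have E : poly_product ((i, p) :: l1 ++ l2) =
  poly_product ((i, q1) :: l1 ++ l2) \- poly_product ((i, q2) :: l1 ++ l2).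
  apply/funext => w; rewrite /= /poly_product !big_cons/= -mulrBl.
  by rewrite -hornerN -hornerD -pE.
rewrite E; split; first by apply: eq_integrable (integrableB measurableT i1 i2).
under eq_integral do rewrite EFinB.
by rewrite integralB_EFin// e1 e2 -EFinB !big_cons/= -mulrBl -gaussian_meanB -pE.
Qed.

Lemma expectation_prod (a : seq I) : (forall i, i \in a -> D i) ->
  P.-integrable [set: T] (fun w => (\prod_(i <- a) X i w)%:E) /\
  (\int[P]_w (\prod_(i <- a) X i w)%:E =
   (\prod_(i <- undup a) gaussian_mean 'X^(count_mem i a))%:E)%E.
Proof.
move=> aD; pose l : seq (I * {poly R}) := [seq (i, 'X^(count_mem i a)) | i <- undup a].
have lE : map fst l = undup a by rewrite -map_comp map_id.
have -> : (fun w => (\prod_(i <- a) X i w)%:E) = EFin \o poly_product (l ++ [::]).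
  apply/funext => w; rewrite /poly_product cats0 /= big_map.
  rewrite -[in LHS]big_undup_iterop_count; congr (_%:E).
  by apply: eq_bigr => i _; rewrite /= hornerXn.
have -> : \prod_(i <- undup a) gaussian_mean 'X^(count_mem i a) =
    \prod_(z <- l ++ [::]) gaussian_mean z.2 :> R.
  by rewrite cats0 big_map.
apply: expectation_poly_product => //; rewrite cats0 lE ?undup_uniq//.
by move=> i; rewrite mem_undup; exact: aD.
Qed.

End independent_gaussians.

Section hermite.
Variable R : comNzRingType.

(** The pair holds the polynomials of index n and n-1, so that the three-term
    recurrence becomes a one-step recursion; the value 0 at index -1 is multiplied
    by 0. *)
Fixpoint hermite_pair (n : nat) : {poly R} * {poly R} :=
  match n with
  | 0 => (1, 0)
  | n'.+1 => let: (p, q) := hermite_pair n' in ('X * p - n'%:R *: q, p)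
  end.

(** The probabilists' Hermite polynomials. *)
Definition hermite n := (hermite_pair n).1.

Lemma hermite_pairE n : hermite_pair n = (hermite n, (hermite_pair n).2).
Proof. by rewrite /hermite; case: (hermite_pair n). Qed.

Lemma hermite0 : hermite 0 = 1. Proof. by []. Qed.

Lemma mulX_hermite n : 'X * hermite n = hermite n.+1 + n%:R *: hermite n.-1.
Proof.
rewrite {2}/hermite/= hermite_pairE/=; case: n => [|n].
  by rewrite !scale0r subr0 addr0.
have -> : (hermite_pair n.+1).2 = hermite n by rewrite /= hermite_pairE.
by rewrite /= subrK.
Qed.

Lemma deriv_hermite n : (hermite n)^`() = n%:R *: hermite n.-1.
Proof.
elim/ltn_ind: n => -[|[|n]] IH.
- by rewrite hermite0 derivC scale0r.
- have := mulX_hermite 0; rewrite hermite0 scale0r addr0 mulr1 => <-.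
  by rewrite derivX scale1r.
have H m : hermite m.+1 = 'X * hermite m - m%:R *: hermite m.-1.
  by rewrite mulX_hermite addrK.
rewrite H derivB derivM derivX mul1r derivZ !IH// H/=.
rewrite -!mul_polyC !polyCMn !polyC1 -[n.+2]addn1 natrD -[n.+1]addn1 natrD.
ring.
Qed.

(** [g] stands for the expectation in a standard Gaussian variable. *)
Lemma mean_hermite (g : {linear {poly R} -> R^o}) n :
  (forall p, g ('X * p) = g p^`()) -> g 1 = 1 -> g (hermite n) = (n == 0%N)%:R.
Proof.
move=> gX g1; case: n => [|n]; first by rewrite hermite0 g1.
have : g ('X * hermite n) = g (hermite n)^`() by exact: gX.
rewrite mulX_hermite deriv_hermite linearD/= => /(congr1 (fun z => z - g (n%:R *: hermite n.-1))).
by rewrite addrK subrr.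
Qed.
End hermite.

Section wick.
Variables (R : comNzRingType) (X : eqType).
Implicit Types a v : seq X.

(** Multiplication by a letter acts on the products of Hermite polynomials as
    creation plus annihilation acts on words: the three-term recurrence
    X H_m = H_(m+1) + m H_(m-1) adds the letter to [v] or removes one of its m
    occurrences.  A product of Hermite polynomials has mean 0 unless [v] is
    empty. *)
Lemma wick_hermite (g : {linear {poly R} -> R^o}) (D a v : seq X) :
  (forall p, g ('X * p) = g p^`()) -> g 1 = 1 ->
  uniq D -> {subset a <= D} -> {subset v <= D} ->
  \prod_(y <- D) (g ('X^(count_mem y a) * hermite R (count_mem y v)) : R) =
  amplitude (fun _ _ => 1) a v.
Proof.
move=> gX g1 uD; elim: a v => [|x a IH] v aD vD /=.
  under eq_bigr => y _ do rewrite /= expr0 mul1r mean_hermite//.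
  case: v vD => [|x v] vD; first by rewrite big1.
  by rewrite (bigD1_seq x)/= ?eqxx ?mul0r// vD ?mem_head.
have xD : x \in D by rewrite aD ?mem_head.
have aD' : {subset a <= D} by move=> y ya; rewrite aD// inE ya orbT.
have xvD : {subset x :: v <= D} by move=> y; rewrite inE => /orP[/eqP->|/vD].
rewrite -IH//.
pose m := count_mem x v.
pose rest := \prod_(y <- D | y != x)
  (g ('X^(count_mem y a) * hermite R (count_mem y v)) : R).
rewrite (bigD1_seq x)//= eqxx add1n exprSr -mulrA mulX_hermite mulrDr linearD/=.
rewrite mulrDl; congr (_ + _).
  rewrite [in RHS](bigD1_seq x)//= eqxx add1n; congr (_ * _).
  by apply: eq_bigr => y /negPf yx; rewrite eq_sym yx.
transitivity (\sum_(k in [pred k : 'I_(size v) | tnth (in_tuple v) k == x])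
    (g ('X^(count_mem x a) * hermite R m.-1) * rest : R)).
  rewrite sumr_const count_tnth -/m -[RHS]mulr_natl mulrA.
  have -> : (g ('X^(count_mem x a) * (m%:R *: hermite R m.-1)) : R) =
      m%:R * g ('X^(count_mem x a) * hermite R m.-1).
    by rewrite -scalerAr linearZ.
  congr (_ * _); apply: eq_bigr => y /negPf yx.
  by rewrite eq_sym yx.
apply: eq_bigr => k /eqP kx.
rewrite big1 ?mul1r// -IH//; last first.
  by move=> y yv; apply: vD; rewrite (perm_mem (perm_remove_at k)) inE yv orbT.
have vk y : count_mem y v = ((x == y) + count_mem y (remove_at v k))%N.
  by rewrite (permP (perm_remove_at k))/= kx.
rewrite [in RHS](bigD1_seq x)//= /m vk eqxx/=; congr (_ * _).
by apply: eq_bigr => y /negPf yx; rewrite vk eq_sym yx.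
Qed.

Lemma wick_moments (g : {linear {poly R} -> R^o}) (a : seq X) :
  (forall p, g ('X * p) = g p^`()) -> g 1 = 1 ->
  \prod_(y <- undup a) (g 'X^(count_mem y a) : R) = amplitude (fun _ _ => 1) a [::].
Proof.
move=> gX g1; rewrite -(@wick_hermite g (undup a))//; last 2 first.
- exact: undup_uniq.
- by move=> y; rewrite mem_undup.
by apply: eq_bigr => y _; rewrite mulr1.
Qed.
End wick.

(** * Products of Majorana fermions *)

Section words.
Variables (K : comNzRingType) (B : algType K) (X : eqType) (e : X -> B).
Variables (G : pred X) (sgn : X -> X -> K).
Hypothesis e_comm : {in G &, forall x y, e x * e y = sgn x y *: (e y * e x)}.
Hypothesis e_sqr : {in G, forall x, e x * e x = 1}.
Implicit Types a v : seq X.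

(** The letter [x] is moved across [v1] to its partner, and the pair cancels. *)
Lemma contract_word x v1 v2 : x \in G -> all G v1 ->
  e x * \prod_(y <- v1 ++ x :: v2) e y =
  (\prod_(y <- v1) sgn x y) *: \prod_(y <- v1 ++ v2) e y.
Proof.
move=> xG; elim: v1 => [_|y v1 IH /= /andP[yG v1G]].
  by rewrite big_nil scale1r/= big_cons mulrA e_sqr// mul1r.
rewrite !big_cons/= mulrA e_comm// -scalerAl -mulrA IH//.
by rewrite -scalerAr scalerA.
Qed.

(** The Wick recursion and its twisted version pick the same contractions; the
    twist is the sign produced when a letter is moved next to its partner. *)
Lemma amplitude_word a v : all G a -> all G v ->
  amplitude (fun _ _ => 1) a v *: (\prod_(x <- rev a) e x * \prod_(x <- v) e x) =
  (amplitude sgn a v)%:A.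
Proof.
elim: a v => [|x a IH] v /= aG vG.
  by case: v vG => [|y v] _; rewrite ?scale0r// !big_nil mulr1.
case/andP: aG => xG aG.
have -> : \prod_(y <- rev (x :: a)) e y * \prod_(y <- v) e y =
    \prod_(y <- rev a) e y * \prod_(y <- x :: v) e y.
  by rewrite rev_cons big_rcons/= big_cons mulrA.
rewrite !scalerDl IH/= ?xG//; congr (_ + _); rewrite !scaler_suml; apply: eq_bigr => k /eqP kx.
have vGk : all G (take k v).
  by move: vG; rewrite -{1}(cat_take_drop k v) all_cat => /andP[].
have vGr : all G (remove_at v k).
  by move: vG; rewrite (perm_all _ (perm_remove_at k))/= => /andP[].
have -> : \prod_(y <- x :: v) e y =
    e x * \prod_(y <- take k v ++ x :: drop k.+1 v) e y.
  by rewrite big_cons -kx -split_at.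
rewrite contract_word//.
rewrite -/(remove_at v k) big1// mul1r -scalerAr scalerA mulrC -[LHS]scalerA.
by rewrite IH// scalerA.
Qed.
End words.

Section map_amplitude.
Lemma rmorph_amplitude (R S : comNzRingType) (f : {rmorphism R -> S}) (X : eqType)
    (w : X -> X -> R) (a v : seq X) :
  f (amplitude w a v) = amplitude (fun x y => f (w x y)) a v.
Proof.
elim: a v => [|x a IH] v /=; first by rewrite rmorph_nat.
rewrite rmorphD IH rmorph_sum; congr (_ + _); apply: eq_bigr => k _.
by rewrite rmorphM rmorph_prod IH.
Qed.

Lemma eq_amplitude (R : comNzRingType) (X : eqType) (w w' : X -> X -> R) (a v : seq X) :
  w =2 w' -> amplitude w a v = amplitude w' a v.
Proof.
move=> ww; elim: a v => [|x a IH] v //=.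
rewrite IH; congr (_ + _); apply: eq_bigr => k _.
by rewrite IH; congr (_ * _); apply: eq_bigr.
Qed.
End map_amplitude.

Section fermions.
Variables (R : realType) (A : algType R[i]) (star : A -> A) (psi : nat -> A).
Hypothesis psi_majorana : majorana_fermions star psi.
Implicit Types s t : seq nat.

Definition fermion_word t : A := \prod_(i <- t) psi i.

Lemma sign_parity (m n : nat) : odd m = odd n -> (-1) ^+ m = (-1) ^+ n :> R[i].
Proof. by move=> mn; rewrite -signr_odd mn signr_odd. Qed.

Lemma fermion_sqr i : (0 < i)%N -> psi i * psi i = 1.
Proof.
move=> i0; have := majorana_CAR psi_majorana i0 i0; rewrite eqxx mulr1 => h.
have two0 : (2%:R : R[i]) != 0 by rewrite pnatr_eq0.
by apply: (scalerI two0); rewrite !scaler_nat mulr2n h.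
Qed.

Lemma fermion_comm i j : (0 < i)%N -> (0 < j)%N ->
  psi i * psi j = (-1) ^+ (i != j) *: (psi j * psi i).
Proof.
move=> i0 j0; case: eqP => [->|/eqP/negPf ij]; first by rewrite scale1r.
rewrite scaleN1r; apply/eqP; rewrite -addr_eq0.
by rewrite (majorana_CAR psi_majorana)// ij mulr0.
Qed.

(** The sign counts the indices of [t] other than [i]: its exponent is congruent
    to their number modulo 2. *)
Lemma fermion_word_comm1 i t : (0 < i)%N -> all (ltn 0) t ->
  psi i * fermion_word t =
  (-1) ^+ (size t + count_mem i t) *: (fermion_word t * psi i).
Proof.
move=> i0; rewrite /fermion_word; elim: t => [_|j t IH /= /andP[j0 t0]].
  by rewrite !big_nil mul1r mulr1 scale1r.
rewrite !big_cons mulrA fermion_comm// -scalerAl -[X in _ *: X]mulrA IH//.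
rewrite -scalerAr scalerA mulrA -exprD; congr (_ *: _).
apply: sign_parity; rewrite eq_sym; case: eqP => _ /=; rewrite !(oddD, oddS)/=;
  by case: (odd (size t)); case: (odd (count_mem i t)).
Qed.

Lemma fermion_word_comm s t : all (ltn 0) s -> all (ltn 0) t -> ~~ odd (size t) ->
  fermion_word s * fermion_word t =
  (\prod_(i <- s) (-1) ^+ count_mem i t) *: (fermion_word t * fermion_word s).
Proof.
move=> + t0 /negPf ot; elim: s => [_|i s IH /= /andP[i0 s0]].
  by rewrite /fermion_word !big_nil mulr1 mul1r scale1r.
rewrite /fermion_word !big_cons -/(fermion_word s) -/(fermion_word t).
rewrite -mulrA IH// -scalerAr [psi i * (_ * _)]mulrA fermion_word_comm1//.
rewrite -scalerAl scalerA -[X in _ *: X]mulrA.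
by rewrite exprD -signr_odd ot mul1r mulrC.
Qed.

Lemma fermion_word_sqr t : all (ltn 0) t -> uniq t ->
  fermion_word t * fermion_word t = ((-1) ^+ 'C(size t, 2))%:A.
Proof.
elim: t => [_ _|i t IH /= /andP[i0 t0] /andP[it ut]].
  by rewrite /fermion_word !big_nil mulr1 bin0n scale1r.
rewrite /fermion_word !big_cons -/(fermion_word t).
rewrite mulrA -[psi i * _ * _]mulrA (_ : _ * psi i =
  (-1) ^+ (size t) *: (psi i * fermion_word t)); last first.
  rewrite fermion_word_comm1// (count_memPn it) addn0 scalerA -expr2 sqrr_sign.
  by rewrite scale1r.
rewrite -scalerAr -scalerAl mulrA fermion_sqr// mul1r IH// scalerA.
by rewrite binS bin1 exprD mulrC.
Qed.

Lemma sign_bin2 h : (-1) ^+ 'C(h.*2, 2) = (-1) ^+ h :> R[i].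
Proof.
elim: h => [|h IH]; first by rewrite bin0n.
have -> : 'C(h.+1.*2, 2) = ('C(h.*2, 2) + h.*2.*2.+1)%N.
  by rewrite doubleS binS bin1 binS bin1 -addnn; lia.
by rewrite exprD IH !exprSr -[in LHS](signr_odd _ h.*2.*2) odd_double mul1r.
Qed.

Lemma majorana_fermion_word t : all (ltn 0) t -> majorana_algebra psi (fermion_word t).
Proof.
rewrite /fermion_word; elim: t => [_|i t IH /= /andP[i0 t0]].
  by rewrite big_nil; exact: majorana_one.
by rewrite big_cons; apply: majorana_mul; [exact: majorana_gen|exact: IH].
Qed.
End fermions.

Section trace.
Variables (R : realType) (A : algType R[i]) (psi : nat -> A) (tr : A -> R[i]).
Hypothesis tr_trace : normalized_trace psi tr.
Local Notation alg := (majorana_algebra psi).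

Lemma majorana_algebra0 : alg 0.
Proof. by rewrite -(addNr 1) -scaleN1r; apply: majorana_lin; exact: majorana_one. Qed.

Lemma trace0 : tr 0 = 0.
Proof.
rewrite -(addNr 1) -scaleN1r (trace_linear tr_trace); try exact: majorana_one.
by rewrite mulN1r addNr.
Qed.

Lemma trace_scale a x : alg x -> tr (a *: x) = a * tr x.
Proof.
move=> xA; rewrite -[a *: x]addr0 (trace_linear tr_trace)//; last exact: majorana_algebra0.
by rewrite trace0 addr0.
Qed.

Lemma trace_sum (U : eqType) (l : seq U) (a : U -> R[i]) (x : U -> A) :
  {in l, forall u, alg (x u)} ->
  tr (\sum_(u <- l) a u *: x u) = \sum_(u <- l) a u * tr (x u).
Proof.
move=> xA; suff [] : alg (\sum_(u <- l) a u *: x u) /\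
    tr (\sum_(u <- l) a u *: x u) = \sum_(u <- l) a u * tr (x u) by [].
elim: l xA => [_|u l IH xA].
  by rewrite !big_nil trace0; split=> //; exact: majorana_algebra0.
have [] := IH; first by move=> v vl; apply: xA; rewrite inE vl orbT.
move=> lA e; have uA : alg (x u) by apply: xA; rewrite mem_head.
by rewrite !big_cons (trace_linear tr_trace)// e; split=> //; exact: majorana_lin.
Qed.

Lemma majorana_algebra_prod (U : eqType) (l : seq U) (x : U -> A) :
  {in l, forall u, alg (x u)} -> alg (\prod_(u <- l) x u).
Proof.
elim: l => [_|u l IH xA]; first by rewrite big_nil; exact: majorana_one.
rewrite big_cons; apply: majorana_mul; first by apply: xA; rewrite mem_head.
by apply: IH => v vl; apply: xA; rewrite inE vl orbT.
Qed.

Lemma majorana_algebraZ a x : alg x -> alg (a *: x).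
Proof.
by move=> xA; rewrite -[_ *: _]addr0; apply: majorana_lin => //; exact: majorana_algebra0.
Qed.
End trace.

(** * Sign sums over sublists *)

Section sublists.
Variable T : eqType.
Implicit Types (s t : seq T).

Fixpoint sublists s : seq (seq T) :=
  if s is x :: s' then map (cons x) (sublists s') ++ sublists s' else [:: [::]].

Definition sublists_of_size r s := [seq t <- sublists s | size t == r].

Lemma mem_sublists s t : (t \in sublists s) = subseq t s.
Proof.
elim: s t => [|x s IH] t; first by case: t.
rewrite [sublists _]/= mem_cat IH; case: t => [|y t]; first by rewrite sub0seq orbT.
have -> : (y :: t \in map (cons x) (sublists s)) = (y == x) && subseq t s.
  apply/mapP/andP => [[u]|[/eqP -> ts]].
    by rewrite IH => us [-> ->].
  by exists t; rewrite ?IH.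
rewrite /=; case: eqP => //= _; apply/orP/idP => [[//|]|]; last by left.
by apply: subseq_trans; exact: subseq_cons.
Qed.

Lemma sublists_uniq s : uniq s -> uniq (sublists s).
Proof.
elim: s => //= x s IH /andP[xs us].
have consI : injective (cons x) by move=> u v [].
rewrite cat_uniq (map_inj_uniq consI) IH//= andbT.
apply/hasPn => u; rewrite mem_sublists => /mem_subseq us'.
by apply/mapP => -[v _ uv]; move: xs; rewrite us'// uv mem_head.
Qed.

Lemma mem_sublists_of_size r s t :
  (t \in sublists_of_size r s) = subseq t s && (size t == r).
Proof. by rewrite mem_filter mem_sublists andbC. Qed.

Lemma size_sublists_of_size r s : size (sublists_of_size r s) = 'C(size s, r).
Proof.
rewrite size_filter; elim: s r => [|x s IH] r; first by case: r.
rewrite [sublists _]/= count_cat IH count_map; case: r => [|r].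
  by rewrite (eq_count (a2 := pred0)) ?count_pred0 ?bin0.
by rewrite (eq_count (a2 := fun u => size u == r)) ?IH ?binS 1?addnC.
Qed.

Lemma sum_sublists (R : comPzRingType) (f : T -> R) s :
  \sum_(t <- sublists s) \prod_(x <- t) f x = \prod_(x <- s) (1 + f x).
Proof.
elim: s => [|x s IH] /=; first by rewrite big_seq1 !big_nil.
rewrite big_cat big_map/= big_cons mulrDl mul1r -IH mulr_sumr addrC.
by congr (_ + _); apply: eq_bigr => t _; rewrite big_cons.
Qed.
End sublists.

Section generating_polynomial.
Variable R : realFieldType.
Implicit Types (p q : {poly R}).

Lemma prod_scaleX (T : Type) (f : T -> R) (t : seq T) :
  \prod_(x <- t) (f x *: 'X) = (\prod_(x <- t) f x) *: 'X^(size t).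
Proof.
elim: t => [|x t IH]; first by rewrite !big_nil scale1r.
by rewrite !big_cons IH -scalerAl -scalerAr scalerA -exprS.
Qed.

(** The generating function of sublists by size is a product over the sites. *)
Lemma sum_sublists_of_size (T : eqType) (f : T -> R) r (s : seq T) :
  \sum_(t <- sublists_of_size r s) \prod_(x <- t) f x =
  (\prod_(x <- s) (1 + f x *: 'X))`_r.
Proof.
rewrite -sum_sublists coef_sum big_filter big_mkcond; apply: eq_bigr => t _.
by rewrite prod_scaleX coefZ coefXn eq_sym; case: eqP; rewrite ?mulr1 ?mulr0.
Qed.

(** Domination is stable under products, and the values of the dominating
    polynomial at nonnegative points bound the coefficients of the other one. *)
Definition dominated p q := forall i, `|p`_i| <= q`_i.

Lemma dominatedM p1 q1 p2 q2 : dominated p1 q1 -> dominated p2 q2 ->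
  dominated (p1 * p2) (q1 * q2).
Proof.
move=> h1 h2 i; rewrite !coefM (le_trans (ler_norm_sum _ _ _))//.
by apply: ler_sum => j _; rewrite normrM ler_pM.
Qed.

Lemma dominated1 : dominated 1 1.
Proof. by move=> i; rewrite coef1; case: (_ == _); rewrite ?normr1 ?normr0. Qed.

Lemma dominatedX p q n : dominated p q -> dominated (p ^+ n) (q ^+ n).
Proof.
move=> h; elim: n => [|n IH]; first by rewrite !expr0; exact: dominated1.
by rewrite !exprS; exact: dominatedM.
Qed.

Lemma dominated_coef_le p q r rho : 0 <= rho -> dominated p q ->
  `|p`_r| * rho ^+ r <= q.[rho].
Proof.
move=> rho0 pq.
have q0 i : 0 <= q`_i by rewrite (le_trans _ (pq i)).
have [rq|rq] := ltnP r (size q).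
  rewrite horner_coef (bigD1 (Ordinal rq))//=.
  rewrite -[leLHS]addr0 lerD ?ler_wpM2r ?exprn_ge0//.
  by apply: sumr_ge0 => i _; rewrite mulr_ge0// exprn_ge0.
have : `|p`_r| <= 0 by rewrite (le_trans (pq r))// nth_default.
rewrite normr_le0 => /eqP ->; rewrite normr0 mul0r horner_coef.
by apply: sumr_ge0 => i _; rewrite mulr_ge0// exprn_ge0.
Qed.

(** The sign sum is the coefficient of X^r in (1-X)^x (1+X)^(n-x), a Krawtchouk
    polynomial in x; pairing factors as (1-X^2)^x (1+X)^(n-2x) and taking
    absolute values of the coefficients keeps most of the cancellation. *)
Lemma krawtchouk_bound (T : eqType) (G : pred T) r (s : seq T) (rho : R) :
  0 <= rho -> ((count G s).*2 <= size s)%N ->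
  `|\sum_(t <- sublists_of_size r s) \prod_(x <- t) (-1) ^+ G x| * rho ^+ r <=
  (1 + rho ^+ 2) ^+ count G s * (1 + rho) ^+ (size s - (count G s).*2).
Proof.
move=> rho0 Gs; rewrite sum_sublists_of_size.
set c := count G s in Gs *; set n := size s.
have -> : \prod_(x <- s) (1 + (-1) ^+ G x *: 'X) =
    (1 - 'X^2) ^+ c * (1 + 'X) ^+ (n - c.*2) :> {poly R}.
  transitivity ((1 - 'X) ^+ c * (1 + 'X) ^+ (count (predC G) s) : {poly R}).
    rewrite /c; elim: (s) => [|x u IH]; first by rewrite big_nil !expr0 mulr1.
    rewrite big_cons IH/=; case: (G x) => /=.
      by rewrite add1n add0n [in RHS]exprS ?expr1 scaleN1r mulrA.
    by rewrite add0n add1n [in RHS]exprS ?expr0 scale1r mulrCA.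
  have -> : count (predC G) s = (c + (n - c.*2))%N.
    have := count_predC G s; rewrite -/c -/n; move: Gs; rewrite -/n -addnn; lia.
  rewrite exprD mulrA -exprMn; congr (_ ^+ _ * _).
  by rewrite mulrDr mulr1 mulrBl mul1r -expr2 addrA subrK.
have dom : dominated ((1 - 'X^2) ^+ c * (1 + 'X) ^+ (n - c.*2))
    ((1 + 'X^2) ^+ c * (1 + 'X) ^+ (n - c.*2)).
  apply: dominatedM; apply: dominatedX => i.
    rewrite coefB coefD coef1 coefXn; case: i => [|[|[|i]]] /=;
    by rewrite ?subr0 ?addr0 ?sub0r ?add0r ?normrN ?normr1 ?normr0.
  rewrite coefD coef1 coefX; case: i => [|[|i]] /=;
  by rewrite ?addr0 ?add0r ?normr1 ?normr0.
apply: (le_trans (dominated_coef_le _ rho0 dom)).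
by rewrite !hornerE.
Qed.
End generating_polynomial.

Section overlap.
Variable R : realFieldType.

(** With ratio r/(n-r) the largest term of the binomial expansion is the r-th
    one, so it is at least the average of the n+1 terms. *)
Lemma binomial_mode (n r : nat) (rho : R) : (r < n)%N ->
  rho = r%:R / (n - r)%:R ->
  (1 + rho) ^+ n <= n.+1%:R * ('C(n, r)%:R * rho ^+ r).
Proof.
move=> rn rhoE; pose b j := 'C(n, j)%:R * rho ^+ j.
have rho0 : 0 <= rho by rewrite rhoE divr_ge0.
have b0 j : 0 <= b j by rewrite mulr_ge0// exprn_ge0.
have bS j : j.+1%:R * b j.+1 = (n - j)%:R * rho * b j.
  rewrite /b exprS !mulrA -natrM mul_bin_left natrM; ring.
have rhor : (n - r)%:R * rho = r%:R.
  by rewrite rhoE mulrCA divff ?mulr1// pnatr_eq0 subn_eq0 -ltnNge.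
have up j : (j < r)%N -> b j <= b j.+1.
  move=> jr; rewrite -(@ler_pM2l _ j.+1%:R) ?ltr0n// bS ler_wpM2r//.
  apply: (@le_trans _ _ r%:R); first by rewrite ler_nat.
  by rewrite -rhor ler_wpM2r// ler_nat leq_sub2l// ltnW.
have down j : (r <= j)%N -> b j.+1 <= b j.
  move=> rj; rewrite -(@ler_pM2l _ j.+1%:R) ?ltr0n// bS ler_wpM2r//.
  apply: (@le_trans _ _ r%:R); last by rewrite ler_nat ltnW.
  by rewrite -rhor ler_wpM2r// ler_nat leq_sub2l.
have le_b j : b j <= b r.
  have [jr|rj] := leqP j r.
    have h k : (k <= r)%N -> b (r - k)%N <= b r.
      elim: k => [|k IH] kr; first by rewrite subn0.
      apply: (le_trans _ (IH (ltnW kr))).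
      have := @up (r - k.+1)%N; rewrite subnSK//; apply.
      by lia.
    by rewrite -(subKn jr) h// leq_subr.
  have h k : b (r + k)%N <= b r.
    elim: k => [|k IH]; first by rewrite addn0.
    by apply: (le_trans _ IH); rewrite addnS down// leq_addr.
  by rewrite -(subnKC (ltnW rj)).
rewrite exprDn -/(b r).
apply: (@le_trans _ _ (\sum_(i < n.+1) b r)).
  by apply: ler_sum => i _; rewrite expr1n mul1r -mulr_natl; exact: le_b.
by rewrite sumr_const card_ord mulr_natl.
Qed.

Variable T : eqType.
Implicit Types (s t u : seq T).

(** The weight of a pair of sublists is a product over the sites, and so is its
    total. *)
Lemma sum_symmetric_difference (B : pred T) (rho beta : R) s : uniq s ->
  \sum_(t <- sublists s) \sum_(u <- sublists s)
    rho ^+ (size t + size u) *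
    beta ^+ count (fun x => B x && ((x \in t) (+) (x \in u))) s =
  \prod_(x <- s)
    (1 + rho ^+ 2 + (rho * (if B x then beta else 1)) *+ 2).
Proof.
elim: s => [|x s IH] /=; first by rewrite !big_seq1 big_nil expr0 mulr1.
move=> /andP[xs us]; rewrite big_cons -IH// => {IH}.
pose wt t u := rho ^+ (size t + size u) *
    beta ^+ count (fun y => B y && ((y \in t) (+) (y \in u))) s.
have cE (b b' : bool) t u : x \notin t -> x \notin u ->
    count (fun y => B y && ((y \in nseq b x ++ t) (+) (y \in nseq b' x ++ u))) s =
    count (fun y => B y && ((y \in t) (+) (y \in u))) s.
  move=> xt xu; apply: eq_in_count => y ys.
  have yx : y != x by apply: contraNneq xs => <-.
  by case: b b' => -[] /=; rewrite ?inE ?(negPf yx).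
have mem_sub t : t \in sublists s -> x \notin t.
  by rewrite mem_sublists => /mem_subseq ts; apply: contra xs => /ts.
pose W := \sum_(t <- sublists s) \sum_(u <- sublists s) wt t u.
pose L b := map (cat (nseq (nat_of_bool b) x)) (sublists s).
pose F t u := rho ^+ (size t + size u) *
    beta ^+ ((B x && ((x \in t) (+) (x \in u))) +
             count (fun x => B x && ((x \in t) (+) (x \in u))) s).
have E (b b' : bool) : \sum_(t <- L b) \sum_(u <- L b') F t u =
    rho ^+ (b + b') * (if B x && (b (+) b') then beta else 1) * W.
  rewrite /L big_map /W mulr_sumr big_seq [RHS]big_seq.
  apply: eq_bigr => t /mem_sub xt.
  rewrite big_map mulr_sumr big_seq [RHS]big_seq; apply: eq_bigr => u /mem_sub xu.
  rewrite /F cE// !size_cat !size_nseq /wt.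
  have mE (c : bool) v : x \notin v -> (x \in nseq c x ++ v) = c.
    by move=> /negPf xv; rewrite mem_cat xv orbF mem_nseq eqxx andbT; case: c.
  rewrite !mE// addnACA !exprD.
  by case: (B x && _); rewrite ?expr1 ?expr0; ring.
have -> : map (cons x) (sublists s) ++ sublists s = L true ++ L false.
  by rewrite /L/= map_id.
transitivity (\sum_(t <- L true ++ L false)
    (\sum_(u <- L true) F t u + \sum_(u <- L false) F t u)).
  by apply: eq_bigr => t _; rewrite big_cat.
rewrite big_cat !big_split/= !E /=.
by rewrite -/W ?andbF ?andbT; case: (B x) => /=; rewrite ?expr0 ?expr1; ring.
Qed.

(** Up to the factor (1+rho)^n / rho^r, at most n+1 times the number of r-subsets
    by [binomial_mode], the inner sum is at most beta^x, where x is the number of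
    sites of [s'] in exactly one of [t] and [u].  The same factor for each of [t]
    and [u] pays for dropping the constraint on their sizes, after which the
    sum of beta^x is a product over the sites. *)
Lemma overlap_bound (s s' : seq T) (n r m : nat) (rho : R) :
  uniq s -> uniq s' -> size s = n -> size s' = n ->
  (0 < r)%N -> (4 * r <= n)%N -> (m <= count (mem s') s)%N ->
  rho = r%:R / (n - r)%:R ->
  \sum_(t <- sublists_of_size r s) \sum_(u <- sublists_of_size r s)
    `|\sum_(v <- sublists_of_size r s')
        \prod_(x <- v) (-1) ^+ ((x \in t) (+) (x \in u))| <=
  (n.+1%:R * 'C(n, r)%:R) ^+ 3 * (1 - (2 * rho / (1 + rho) ^+ 2) ^+ 2) ^+ m.
Proof.
move=> us us' sn s'n r0 rn4 mB rhoE.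
have rn : (r < n)%N by lia.
have rho0 : 0 < rho by rewrite rhoE divr_gt0 ?ltr0n// subn_gt0.
have rhoV : 1 + rho != 0 by rewrite gt_eqF// addr_gt0.
pose beta := (1 + rho ^+ 2) / (1 + rho) ^+ 2.
have rho2 : 0 < (1 + rho) ^+ 2 by rewrite exprn_gt0// addr_gt0.
have beta0 : 0 <= beta by rewrite divr_ge0 ?(ltW rho2)// addr_ge0// sqr_ge0.
have beta1 : beta <= 1 by rewrite ler_pdivrMr// mul1r; nra.
set gam := 1 - _ ^+ 2.
have gamE : 1 + rho ^+ 2 + (rho * beta) *+ 2 = (1 + rho) ^+ 2 * gam.
  by rewrite /gam /beta; field.
have gam0 : 0 <= gam.
  by rewrite -(pmulr_rge0 _ rho2) -gamE !addr_ge0// ?sqr_ge0// mulr_ge0// ltW.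
have gam1 : gam <= 1 by rewrite gerBl sqr_ge0.
pose Z := (1 + rho) ^+ n; pose M : R := n.+1%:R * 'C(n, r)%:R.
have Z0 : 0 <= Z by rewrite exprn_ge0// addr_ge0// ltW.
have ZM : Z <= M * rho ^+ r by rewrite -mulrA; exact: binomial_mode.
have rr0 : 0 < rho ^+ r by rewrite exprn_gt0.
have one t u : size t = r -> size u = r ->
    `|\sum_(v <- sublists_of_size r s')
        \prod_(x <- v) (-1) ^+ ((x \in t) (+) (x \in u))| * rho ^+ r <=
    Z * beta ^+ count (fun x => (x \in s') && ((x \in t) (+) (x \in u))) s.
  move=> tr ur; pose G x := (x \in t) (+) (x \in u).
  have Gs' : ((count G s').*2 <= size s')%N.
    suff : (count G s' <= size (t ++ u))%N by rewrite size_cat s'n; lia.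
    rewrite -size_filter uniq_leq_size ?filter_uniq// => x.
    by rewrite mem_filter mem_cat /G => /andP[]; case: (x \in t); case: (x \in u).
  apply: (le_trans (krawtchouk_bound r (ltW rho0) Gs')).
  have -> : (1 + rho ^+ 2) ^+ count G s' *
      (1 + rho) ^+ (size s' - (count G s').*2) = Z * beta ^+ count G s'.
    rewrite /Z -[in RHS]s'n -[X in _ = (_ ^+ X) * _](subnK Gs') exprD.
    rewrite -mul2n exprM /beta expr_div_n.
    by field; rewrite !expf_neq0.
  rewrite ler_wpM2l// ler_wiXn2l//.
  rewrite -!size_filter uniq_leq_size ?filter_uniq// => x.
  by rewrite !mem_filter => /andP[/andP[/= xs' Gx] _]; rewrite /G Gx xs'.
rewrite -/M -(ler_pM2r (exprn_gt0 3 rr0)).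
have sub_le (F : seq T -> seq T -> R) : (forall t u, 0 <= F t u) ->
    \sum_(t <- sublists_of_size r s) \sum_(u <- sublists_of_size r s) F t u <=
    \sum_(t <- sublists s) \sum_(u <- sublists s) F t u.
  move=> F0; rewrite big_filter big_mkcond; apply: ler_sum => t _.
  case: ifP => _; last by apply: sumr_ge0.
  by rewrite big_filter big_mkcond; apply: ler_sum => u _; case: ifP.
pose W t u := rho ^+ (size t + size u) *
  beta ^+ count (fun x => (x \in s') && ((x \in t) (+) (x \in u))) s.
apply: (@le_trans _ _ (Z * \sum_(t <- sublists_of_size r s)
    \sum_(u <- sublists_of_size r s) W t u)).
  rewrite mulr_suml mulr_sumr big_seq [leRHS]big_seq; apply: ler_sum => t.
  rewrite mem_sublists_of_size => /andP[_ /eqP tr].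
  rewrite mulr_suml mulr_sumr big_seq [leRHS]big_seq; apply: ler_sum => u.
  rewrite mem_sublists_of_size => /andP[_ /eqP ur].
  rewrite /W tr ur exprD; have := one t u tr ur.
  move: (`|_|) (beta ^+ _) (rho ^+ r) rr0 => a b q q0 ab.
  have -> : Z * (q * q * b) = Z * b * q ^+ 2 by ring.
  have -> : a * q ^+ 3 = a * q * q ^+ 2 by ring.
  by rewrite ler_wpM2r// exprn_ge0// ltW.
apply: (@le_trans _ _ (Z * (Z ^+ 2 * gam ^+ m))).
  rewrite ler_wpM2l// (le_trans (sub_le _ _))//.
    by move=> t u; rewrite mulr_ge0 ?exprn_ge0// ltW.
  rewrite sum_symmetric_difference//.
  have -> : \prod_(x <- s)
      (1 + rho ^+ 2 + (rho * (if x \in s' then beta else 1)) *+ 2) =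
      Z ^+ 2 * gam ^+ count (mem s') s.
    rewrite /Z -sn -exprM mulnC exprM; elim: (s) => [|x q IH].
      by rewrite big_nil !expr0 mulr1.
    rewrite big_cons IH /= [_ ^+ (size q).+1]exprS; case: (x \in s') => /=.
      by rewrite gamE add1n [gam ^+ _.+1]exprS; ring.
    by rewrite add0n mulr1; ring.
  by apply: ler_wpM2l; [exact: exprn_ge0|exact: ler_wiXn2l].
move: (gam ^+ m) (exprn_ge0 m gam0) (rho ^+ r) ZM => g g0 q ZM.
have -> : Z * (Z ^+ 2 * g) = Z ^+ 3 * g by ring.
have -> : M ^+ 3 * g * q ^+ 3 = (M * q) ^+ 3 * g by ring.
by rewrite ler_wpM2r// lerXn2r// nnegrE (le_trans Z0).
Qed.

End overlap.

(** * Amplitudes averaged over labels *)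

Section averages.
Variable R : realFieldType.

Definition average (S : Type) (s : seq S) (f : S -> R) : R :=
  (size s)%:R^-1 * \sum_(t <- s) f t.

Section average_theory.
Variable S : eqType.
Implicit Types (s : seq S) (f g : S -> R).

Lemma eq_average s f g : {in s, f =1 g} -> average s f = average s g.
Proof. by move=> fg; congr (_ * _); exact: eq_big_seq. Qed.

Lemma le_average s f g : {in s, forall t, f t <= g t} -> average s f <= average s g.
Proof.
move=> fg; rewrite ler_wpM2l// big_seq [leRHS]big_seq.
by apply: ler_sum => t; exact: fg.
Qed.

Lemma average_cst s (k : R) : s != [::] -> average s (fun=> k) = k.
Proof.
move=> s0; rewrite /average big_const_seq count_predT iter_addr_0 -[X in _ * X]mulr_natl.
by rewrite mulKf// pnatr_eq0 size_eq0.
Qed.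

Lemma average_linear s a f g :
  average s (fun t => a * f t + g t) = a * average s f + average s g.
Proof. by rewrite /average big_split/= -mulr_sumr mulrDr mulrCA. Qed.

Lemma norm_average s f : `|average s f| <= average s (fun t => `|f t|).
Proof.
rewrite /average normrM ger0_norm// ler_wpM2l//; exact: ler_norm_sum.
Qed.

Lemma averageMl s a f : average s (fun t => a * f t) = a * average s f.
Proof. by rewrite /average -mulr_sumr mulrCA. Qed.

Lemma averageMr s a f : average s (fun t => f t * a) = average s f * a.
Proof. by rewrite /average -mulr_suml mulrA. Qed.
End average_theory.

Section word_average.
Variables (C S : eqType) (L : C -> seq S).
Implicit Types (c : seq C) (v : seq (C * S)) (F G : seq (C * S) -> R).

(** Uniform average over the words whose letters have prescribed colours. *)
Fixpoint word_average c F : R :=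
  if c is i :: c' then
    average (L i) (fun t => word_average c' (fun v => F ((i, t) :: v)))
  else F [::].

Definition labelled c v := (map fst v == c) && all (fun y => y.2 \in L y.1) v.

Lemma labelled_cons i t c v : t \in L i -> labelled c v ->
  labelled (i :: c) ((i, t) :: v).
Proof. by move=> tL /andP[/eqP <- vL]; rewrite /labelled/= eqxx tL. Qed.

Lemma eq_word_average c F G : (forall v, labelled c v -> F v = G v) ->
  word_average c F = word_average c G.
Proof.
elim: c F G => [|i c IH] F G FG /=; first exact: FG.
apply: eq_average => t tL; apply: IH => v cv.
by apply: FG; exact: labelled_cons.
Qed.

Lemma le_word_average c F G : (forall v, labelled c v -> F v <= G v) ->
  word_average c F <= word_average c G.
Proof.
elim: c F G => [|i c IH] F G FG /=; first exact: FG.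
apply: le_average => t tL; apply: IH => v cv.
by apply: FG; exact: labelled_cons.
Qed.

Lemma word_average_linear c a F G :
  word_average c (fun v => a * F v + G v) = a * word_average c F + word_average c G.
Proof.
elim: c F G => [|i c IH] F G //=.
by rewrite -average_linear; apply: eq_average => t _; exact: IH.
Qed.

Lemma word_average0 c : word_average c (fun=> 0) = 0.
Proof.
elim: c => //= i c IH; rewrite (eq_average (g := fun=> 0)) => [|t _]; last exact: IH.
by rewrite /average big1 ?mulr0.
Qed.

Lemma word_averageD c F G :
  word_average c (fun v => F v + G v) = word_average c F + word_average c G.
Proof.
rewrite -[X in _ = X + _]mul1r -word_average_linear.
by apply: eq_word_average => v _; rewrite mul1r.
Qed.

Lemma word_averageMl c a F :
  word_average c (fun v => a * F v) = a * word_average c F.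
Proof.
rewrite -[RHS]addr0 -(word_average0 c) -word_average_linear.
by apply: eq_word_average => v _; rewrite addr0.
Qed.

Lemma word_average_sum c (I : Type) (r : seq I) (P : pred I) (F : I -> seq (C * S) -> R) :
  word_average c (fun v => \sum_(k <- r | P k) F k v) =
  \sum_(k <- r | P k) word_average c (F k).
Proof.
elim: r => [|k r IH].
  rewrite big_nil -[RHS](word_average0 c).
  by apply: eq_word_average => v _; rewrite big_nil.
rewrite big_cons -IH; case: ifP => Pk; last first.
  by apply: eq_word_average => v _; rewrite big_cons Pk.
by rewrite -word_averageD; apply: eq_word_average => v _; rewrite big_cons Pk.
Qed.

Lemma norm_word_average c F : `|word_average c F| <= word_average c (fun v => `|F v|).
Proof.
elim: c F => [|i c IH] F //=; apply: (le_trans (norm_average _ _)).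
by apply: le_average => t _; exact: IH.
Qed.

Lemma word_average_cat c1 c2 F : word_average (c1 ++ c2) F =
  word_average c1 (fun v1 => word_average c2 (fun v2 => F (v1 ++ v2))).
Proof.
elim: c1 F => [|i c1 IH] F //=; apply: eq_average => t _; exact: IH.
Qed.

Lemma word_average_exchange c (s : seq S) (F : S -> seq (C * S) -> R) :
  word_average c (fun v => average s (F^~ v)) =
  average s (fun t => word_average c (F t)).
Proof.
rewrite /average -word_average_sum -word_averageMl.
by apply: eq_word_average => v _.
Qed.

Lemma word_average_prod c (f : C * S -> R) :
  word_average c (fun v => \prod_(y <- v) f y) =
  \prod_(i <- c) average (L i) (fun t => f (i, t)).
Proof.
elim: c => [|i c IH] /=; first by rewrite !big_nil.
rewrite big_cons -IH -averageMr; apply: eq_average => t _.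
by rewrite -word_averageMl; apply: eq_word_average => v _; rewrite big_cons.
Qed.

Hypothesis L_neq0 : forall i, L i != [::].

Lemma word_average_cst c (k : R) : word_average c (fun=> k) = k.
Proof.
elim: c => //= i c IH; rewrite (eq_average (g := fun=> k)) => [|t _]; last exact: IH.
exact: average_cst.
Qed.

(** The variance of the absolute value of [F] is nonnegative. *)
Lemma word_average_jensen c F :
  (word_average c (fun v => `|F v|)) ^+ 2 <= word_average c (fun v => F v ^+ 2).
Proof.
set a := word_average c _.
have : 0 <= word_average c (fun v => (`|F v| - a) ^+ 2).
  rewrite -(word_average0 c); apply: le_word_average => v _; exact: sqr_ge0.
rewrite (eq_word_average (G := fun v => - (2 * a) * `|F v| + (F v ^+ 2 + a ^+ 2))).
  rewrite word_average_linear word_averageD word_average_cst -/a; nra.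
by move=> v _; rewrite sqrrB real_normK ?num_real//; ring.
Qed.
End word_average.
End averages.

Section averaged_process.
Variables (R : realFieldType) (C S : eqType) (L : C -> seq S).
Variable sgn : C * S -> C * S -> R.
Hypothesis sgn_le1 : forall x y, `|sgn x y| <= 1.
Implicit Types (ks c : seq C) (v : seq (C * S)).

(** The amplitude with the twist [sgn] averaged over the labels of the letters
    of [ks]; a contracted letter carries the label of its partner. *)
Fixpoint mean_amplitude ks v : R :=
  if ks is i :: ks' then
    average (L i) (fun t => mean_amplitude ks' ((i, t) :: v)) +
    \sum_(k < size v | (tnth (in_tuple v) k).1 == i)
      (\prod_(y <- take k v) sgn (tnth (in_tuple v) k) y) *
      mean_amplitude ks' (remove_at v k)
  else (v == [::])%:R.

(** The number of terms of the recursion; it does not depend on the labels. *)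
Fixpoint amplitude_bound ks (n : nat) : R :=
  if ks is _ :: ks' then amplitude_bound ks' n.+1 + n%:R * amplitude_bound ks' n.-1
  else 1.

Lemma amplitude_bound_ge0 ks n : 0 <= amplitude_bound ks n.
Proof. by elim: ks n => //= k ks IH n; rewrite addr_ge0// mulr_ge0. Qed.

Lemma norm_prod_sgn x v : `|\prod_(y <- v) sgn x y| <= 1.
Proof.
elim: v => [|y v IH]; first by rewrite big_nil normr1.
by rewrite big_cons normrM mulr_ile1.
Qed.

Lemma mean_amplitude_le (L_neq0 : forall i, L i != [::]) ks v :
  `|mean_amplitude ks v| <= amplitude_bound ks (size v).
Proof.
elim: ks v => [|i ks IH] v /=; first by case: eqP => _; rewrite ?normr1 ?normr0.
apply: (le_trans (ler_normD _ _)); apply: lerD.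
  apply: (le_trans (norm_average _ _)).
  rewrite -[leRHS](average_cst _ (L_neq0 i)).
  by apply: le_average => t _; exact: IH.
apply: (le_trans (ler_norm_sum _ _ _)).
apply: (@le_trans _ _ (\sum_(k < size v) amplitude_bound ks (size v).-1)); last first.
  by rewrite sumr_const card_ord mulr_natl.
rewrite big_mkcond; apply: ler_sum => k _; case: ifP => _; last exact: amplitude_bound_ge0.
rewrite normrM -[leRHS]mul1r ler_pM// ?norm_prod_sgn//.
by rewrite -(size_remove_at k); exact: IH.
Qed.

(** In the term where [i] is contracted with the k-th letter of the word, the label
    [t] of this letter occurs only in the signs of the letters it crosses, so it
    can be averaged separately. *)
Lemma word_average_mean_amplitude i ks c :
  word_average L c (mean_amplitude (i :: ks)) =
  word_average L (i :: c) (mean_amplitude ks) +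
  \sum_(k < size c | tnth (in_tuple c) k == i)
    word_average L (take k c) (fun v1 =>
      average (L i) (fun t => \prod_(y <- v1) sgn (i, t) y) *
      word_average L (drop k.+1 c) (fun v2 => mean_amplitude ks (v1 ++ v2))).
Proof.
rewrite /= word_averageD; congr (_ + _).
  by rewrite (word_average_exchange L c (L i) (fun t v => mean_amplitude ks ((i, t) :: v))).
pose F k v := if drop k v is x :: v2 then
    \prod_(y <- take k v) sgn x y * mean_amplitude ks (take k v ++ v2) else 0.
transitivity (word_average L c (fun v =>
    \sum_(k < size c | tnth (in_tuple c) k == i) F k v)).
  apply: eq_word_average => v /andP[/eqP cE _].
  have FE (k : 'I_(size v)) : F k v =
      (\prod_(y <- take k v) sgn (tnth (in_tuple v) k) y) *
      mean_amplitude ks (remove_at v k).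
    case: v k {cE} => [|x0 v] k; first by case: k.
    by rewrite /F (drop_nth x0) ?ltn_ord// (tnth_nth x0).
  under eq_bigr => k _ do rewrite -FE.
  case: v cE {FE} => [|x0 v] <-; first by rewrite !big_ord0.
  under eq_bigl => k do rewrite (tnth_nth x0)/=.
  under [RHS]eq_bigl => k do rewrite (tnth_nth x0.1)/=.
  rewrite -(big_mkord (fun k => (nth x0 (x0 :: v) k).1 == i) (fun k => F k (x0 :: v))).
  rewrite -(big_mkord (fun k => nth x0.1 (map fst (x0 :: v)) k == i)
    (fun k => F k (x0 :: v))).
  rewrite size_map; apply: congr_big_nat => // k /andP[_ kv].
  by rewrite (nth_map x0).
rewrite word_average_sum; apply: eq_bigr => k /eqP ki.
rewrite {1}(split_at k) ki word_average_cat.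
apply: eq_word_average => v1 /andP[/eqP cv1 _] /=.
rewrite -averageMr; apply: eq_average => t _.
rewrite -word_averageMl; apply: eq_word_average => v2 _.
have sv1 : size v1 = k.
  by rewrite -(size_map fst) cv1 size_take ltn_ord.
by rewrite /F drop_size_cat// take_size_cat.
Qed.
End averaged_process.

Section words_over_colours.
Variables (C S : eqType) (L : C -> seq S).
Implicit Types (c : seq C) (a v : seq (C * S)).

(** The words of letters [(i, t)] with [t] among the labels of the colour [i], for
    a given word of colours. *)
Fixpoint coloured_words c : seq (seq (C * S)) :=
  if c is i :: c' then [seq (i, t) :: a | t <- L i, a <- coloured_words c']
  else [:: [::]].

Lemma sum_coloured_words (V : nmodType) (F : seq (C * S) -> V) i c :
  \sum_(a <- coloured_words (i :: c)) F a =
  \sum_(t <- L i) \sum_(a <- coloured_words c) F ((i, t) :: a).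
Proof. by rewrite /= big_allpairs_dep. Qed.

Lemma mem_coloured_words c a : a \in coloured_words c ->
  all (fun y => y.2 \in L y.1) a.
Proof.
elim: c a => [|i c IH] a /=; first by rewrite inE => /eqP ->.
by case/allpairsP => -[t b] /= [tL /IH bL ->] /=; rewrite tL.
Qed.

Lemma size_coloured_words c a : a \in coloured_words c -> size a = size c.
Proof.
elim: c a => [|i c IH] a /=; first by rewrite inE => /eqP ->.
by case/allpairsP => -[t b] /= [_ /IH bL ->] /=; rewrite bL.
Qed.

Lemma prod_sum_coloured_words (B : pzSemiRingType) (F : C * S -> B) c :
  \prod_(i <- rev c) (\sum_(t <- L i) F (i, t)) =
  \sum_(a <- coloured_words c) \prod_(y <- rev a) F y.
Proof.
elim: c => [|i c IH]; first by rewrite big_seq1 !big_nil.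
rewrite rev_cons big_rcons/= IH sum_coloured_words mulr_suml exchange_big/=.
apply: eq_bigr => a _; rewrite mulr_sumr; apply: eq_bigr => t _.
by rewrite rev_cons big_rcons.
Qed.

(** Each letter carries the normalization [alpha]; a contraction uses up the
    normalization of two letters, which is exactly the weight of one average
    over labels. *)
Lemma sum_amplitude_coloured_words (R : realFieldType) (alpha : R) (N : nat)
    (sgn : C * S -> C * S -> R) c v :
  (forall i, size (L i) = N) -> (forall i, uniq (L i)) -> alpha ^+ 2 = N%:R^-1 ->
  all (fun y => y.2 \in L y.1) v ->
  (\sum_(a <- coloured_words c) amplitude sgn a v) * alpha ^+ size c =
  alpha ^+ size v * mean_amplitude L sgn c v.
Proof.
move=> LN Lu alphaE; elim: c v => [|i c IH] v vL.
  by rewrite big_seq1 expr0 mulr1/=; case: eqP => [->|]; rewrite ?expr0 ?mulr0 ?mulr1.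
rewrite sum_coloured_words /= mulrDr.
under eq_bigr => t _ do rewrite big_split/=.
rewrite big_split/= mulrDl; congr (_ + _).
  rewrite exprS mulr_suml /average LN -alphaE mulr_sumr mulr_sumr.
  rewrite big_seq [RHS]big_seq; apply: eq_bigr => t tL.
  rewrite mulrCA IH/= ?tL// exprS; ring.
rewrite mulr_suml.
transitivity (\sum_(t <- L i) \sum_(k < size v | tnth (in_tuple v) k == (i, t))
    alpha ^+ size v * ((\prod_(y <- take k v) sgn (tnth (in_tuple v) k) y) *
      mean_amplitude L sgn c (remove_at v k))).
  apply: eq_bigr => t _; rewrite exchange_big/= mulr_suml.
  apply: eq_bigr => k /eqP kt; rewrite -mulr_sumr kt exprS -mulrA.
  have vr : all (fun y => y.2 \in L y.1) (remove_at v k).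
    by move: vL; rewrite (perm_all _ (perm_remove_at k))/= => /andP[].
  rewrite (mulrCA _ alpha) IH// size_remove_at.
  have v0 : (0 < size v)%N by apply: leq_ltn_trans (ltn_ord k).
  have -> : alpha ^+ size v = alpha * alpha ^+ (size v).-1.
    by rewrite -exprS prednK.
  by ring.
rewrite mulr_sumr.
under eq_bigr => t _ do rewrite big_mkcond.
rewrite exchange_big/= [RHS]big_mkcond; apply: eq_bigr => k _.
set X := alpha ^+ _ * _; set y := tnth _ _.
have yL : y.2 \in L y.1 by apply: (allP vL); exact: mem_tnth.
case: (eqVneq y.1 i) => [yi|yi]; last first.
  by rewrite big1// => t _; case: eqP => // yt; rewrite yt eqxx in yi.
rewrite -yi (bigD1_seq y.2)//= -surjective_pairing eqxx big1 ?addr0// => t ty.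
by case: eqP => // yt; rewrite [X in t != X.2]yt eqxx in ty.
Qed.
End words_over_colours.

Section limit_of_averaged_process.
Variables (R : realType) (C S : eqType) (L : nat -> C -> seq S).
Variables (sgn : C * S -> C * S -> R) (Q : C -> C -> R).
Hypothesis sgn_le1 : forall x y, `|sgn x y| <= 1.
Hypothesis Q01 : forall i j, Q i j = 0 \/ Q i j = 1.
Hypothesis L_neq0 : \forall m \near \oo, forall i, L m i != [::].
Hypothesis commuting : \forall m \near \oo, forall i j t u,
  Q i j = 1 -> t \in L m i -> u \in L m j -> sgn (i, t) (j, u) = 1.
Hypothesis crossing : forall i c, has (fun j => Q i j == 0) c ->
  word_average (L m) c (fun v =>
    `|average (L m i) (fun t => \prod_(y <- v) sgn (i, t) y)|) @[m --> \oo] --> (0 : R).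
Implicit Types (ks c : seq C).

(** By induction on [ks].  In each contraction the crossed letters either all have
    q = 1, and then every sign is 1, or one of them has q = 0; in the second case
    the average of the signs over the contracted label tends to 0 in mean, and the
    remaining factor is bounded. *)
Lemma mean_amplitude_cvg ks c :
  word_average (L m) c (mean_amplitude (L m) sgn ks) @[m --> \oo] -->
  amplitude Q ks c.
Proof.
elim: ks c => [|i ks IH] c.
  apply: cvg_near_cst; near=> m.
  have Lm : forall i, L m i != [::] by near: m.
  rewrite (eq_word_average (G := fun=> (c == [::])%:R)).
    by rewrite word_average_cst.
  by move=> v /andP[/eqP <- _]; case: v.
under eq_fun do rewrite word_average_mean_amplitude.
rewrite [amplitude _ _ _]/=; apply: cvgD; first exact: IH.
apply: cvg_big => [|k /eqP ki]; first exact: add_continuous.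
set c1 := take k c; set c2 := drop k.+1 c.
have [Q0|Q1] := boolP (has (fun j => Q i j == 0) c1); last first.
  have Q1' : {in c1, forall j, Q i j = 1}.
    move=> j jc; case: (Q01 i j) => // Q0; case/hasP: Q1; exists j => //.
    by rewrite Q0.
  rewrite big_seq big1 ?mul1r; last by move=> j /Q1'.
  apply: cvg_trans (IH (remove_at c k)); apply: near_eq_cvg; near=> m.
  rewrite /remove_at -/c1 -/c2 word_average_cat.
  have Lm : forall i, L m i != [::] by near: m.
  have cm : forall i j t u,
    Q i j = 1 -> t \in L m i -> u \in L m j -> sgn (i, t) (j, u) = 1 by near: m.
  apply: eq_word_average => v1 /andP[/eqP vc vL].
  rewrite (eq_average (g := fun=> 1)) ?average_cst ?mul1r// => t tL.
  rewrite big_seq big1// => -[j u] yv; apply: cm => //.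
    by apply: Q1'; rewrite -vc; apply/mapP; exists (j, u).
  by have /allP/(_ _ yv) := vL.
have -> : \prod_(j <- c1) Q i j = 0.
  by have [j jc /eqP Qj] := hasP Q0; rewrite (big_rem j)//= Qj mul0r.
rewrite mul0r.
pose b := amplitude_bound R ks (size (remove_at c k)).
apply/norm_cvg0P.
have hb : word_average (L m) c1 (fun v =>
    `|average (L m i) (fun t => \prod_(y <- v) sgn (i, t) y)|) * b @[m --> \oo] -->
    (0 : R).
  by rewrite -(mul0r b); apply: cvgMr_tmp; exact: crossing.
apply: (squeeze_cvgr _ (cvg_cst 0) hb).
near=> m.
have Lm : forall i, L m i != [::] by near: m.
rewrite normr_ge0/= (le_trans (norm_word_average _ _ _))//.
rewrite mulrC -word_averageMl; apply: le_word_average => v1 /andP[/eqP vc vL].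
rewrite normrM mulrC ler_wpM2r//.
rewrite (le_trans (norm_word_average _ _ _))//.
rewrite -[leRHS](word_average_cst Lm c2); apply: le_word_average => v2 /andP[/eqP vc2 _].
apply: (le_trans (mean_amplitude_le sgn_le1 Lm ks _)).
by rewrite /b /remove_at -/c1 -/c2 -vc -vc2 -map_cat size_map.
Unshelve. all: by end_near. Qed.
End limit_of_averaged_process.

(** * Exchange signs of random sublists *)

Section exchange_sign.
Variables (R : realFieldType) (T : eqType).
Implicit Types t u : seq T.

(** (-1)^k, where k is the number of entries of [t] that lie in [u]: for duplicate-free
    lists, the sign by which two even products of fermions commute. *)
Definition exchange_sign t u : R := \prod_(x <- t) (-1) ^+ (x \in u).

Lemma exchange_signE t u : exchange_sign t u = (-1) ^+ count (mem u) t.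
Proof.
rewrite /exchange_sign; elim: t => [|x t IH]; first by rewrite big_nil.
by rewrite big_cons IH exprD.
Qed.

Lemma exchange_signC t u : uniq t -> uniq u -> exchange_sign t u = exchange_sign u t.
Proof.
move=> ut uu; rewrite !exchange_signE -!size_filter; congr (_ ^+ _).
apply/perm_size/uniq_perm; rewrite ?filter_uniq// => x.
by rewrite !mem_filter andbC.
Qed.

Lemma norm_exchange_sign t u : `|exchange_sign t u| = 1.
Proof. by rewrite exchange_signE normrX normrN1 expr1n. Qed.

Lemma exchange_sign_disjoint t u : ~~ has (mem u) t -> exchange_sign t u = 1.
Proof. by rewrite exchange_signE has_count -leqNgt leqn0 => /eqP ->. Qed.
End exchange_sign.

Section crossing_estimate.
Variables (R : realFieldType) (C T : eqType) (s : C -> seq T) (n r : nat).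
Hypothesis s_uniq : forall i, uniq (s i).
Hypothesis s_size : forall i, size (s i) = n.
Hypotheses (r_gt0 : (0 < r)%N) (r_le : (4 * r <= n)%N).

Local Notation L := (fun i => sublists_of_size r (s i)).
Local Notation sgn := (fun x y : C * seq T => exchange_sign R x.2 y.2).

Lemma sublists_of_size_neq0 i : L i != [::].
Proof. by rewrite -size_eq0 size_sublists_of_size s_size -lt0n bin_gt0; lia. Qed.

Lemma uniq_sublist i t : t \in L i -> uniq t.
Proof. by rewrite mem_sublists_of_size => /andP[/subseq_uniq -> //]. Qed.

(** By the Cauchy-Schwarz inequality a crossing may be estimated with two
    independent copies of the contracted letter; the signs then factor over the
    letters it crosses, and one of these factors is small. *)
Lemma crossing_bound (i j : C) (c : seq C) (m : nat) (rho : R) :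
  j \in c -> (m <= count (mem (s j)) (s i))%N -> rho = r%:R / (n - r)%:R ->
  word_average L c (fun v =>
    `|average (L i) (fun t => \prod_(y <- v) sgn (i, t) y)|) ^+ 2 <=
  n.+1%:R ^+ 3 * (1 - (2 * rho / (1 + rho) ^+ 2) ^+ 2) ^+ m.
Proof.
move=> jc mB rhoE.
apply: (le_trans (word_average_jensen sublists_of_size_neq0 _ _)).
pose f k t u := average (L k) (fun w => sgn (i, t) (k, w) * sgn (i, u) (k, w)).
have -> : word_average L c (fun v =>
    average (L i) (fun t => \prod_(y <- v) sgn (i, t) y) ^+ 2) =
    average (L i) (fun t => average (L i) (fun u => \prod_(k <- c) f k t u)).
  rewrite (eq_word_average (G := fun v => average (L i) (fun t => average (L i)
      (fun u => \prod_(y <- v) (sgn (i, t) y * sgn (i, u) y))))); last first.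
    move=> v _; rewrite expr2 -averageMr; apply: eq_average => t _.
    rewrite -averageMl; apply: eq_average => u _.
    by rewrite big_split.
  rewrite (word_average_exchange L c (L i) (fun t v => average (L i)
      (fun u => \prod_(y <- v) (sgn (i, t) y * sgn (i, u) y)))).
  apply: eq_average => t _.
  rewrite (word_average_exchange L c (L i) (fun u v =>
      \prod_(y <- v) (sgn (i, t) y * sgn (i, u) y))).
  apply: eq_average => u _.
  exact: (word_average_prod L c (fun y => sgn (i, t) y * sgn (i, u) y)).
have f_le1 k t u : `|f k t u| <= 1.
  apply: (le_trans (norm_average _ _)).
  rewrite -[leRHS](average_cst _ (sublists_of_size_neq0 k)).
  by apply: le_average => w _; rewrite normrM !norm_exchange_sign mulr1.
have prod_le t u : \prod_(k <- c) f k t u <= `|f j t u|.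
  apply: (le_trans (ler_norm _)); rewrite (big_rem j)//= normrM.
  rewrite -[leRHS]mulr1 ler_wpM2l//.
  elim: (rem j c) => [|k c' IH]; first by rewrite big_nil normr1.
  by rewrite big_cons normrM mulr_ile1.
apply: (@le_trans _ _ (average (L i) (fun t => average (L i) (fun u => `|f j t u|)))).
  by apply: le_average => t _; apply: le_average => u _.
have fE t u : t \in L i -> u \in L i ->
    f j t u = average (L j) (fun w => \prod_(x <- w) (-1) ^+ ((x \in t) (+) (x \in u))).
  move=> tL uL; apply: eq_average => w wL.
  rewrite (exchange_signC _ (uniq_sublist tL) (uniq_sublist wL)).
  rewrite (exchange_signC _ (uniq_sublist uL) (uniq_sublist wL)).
  rewrite /exchange_sign -big_split; apply: eq_bigr => x _ /=.
  by rewrite -signr_addb.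
pose N : R := 'C(n, r)%:R.
have N0 : 0 < N by rewrite ltr0n bin_gt0; lia.
have SN k : size (L k) = 'C(n, r) by rewrite size_sublists_of_size s_size.
have := overlap_bound (s_uniq i) (s_uniq j) (s_size i) (s_size j) r_gt0 r_le mB rhoE.
set X := \sum_(t <- _) _ => HX.
have -> : average (L i) (fun t => average (L i) (fun u => `|f j t u|)) = (N ^+ 3)^-1 * X.
  rewrite /average SN -/N /X mulr_sumr mulr_sumr big_seq [RHS]big_seq.
  apply: eq_bigr => t tL; rewrite mulrA !mulr_sumr big_seq [RHS]big_seq.
  apply: eq_bigr => u uL; rewrite fE// /average SN -/N normrM ger0_norm ?invr_ge0 ?ltW//.
  by rewrite mulrA; congr (_ * _); rewrite exprS expr2 !invfM mulrA.
rewrite mulrC ler_pdivrMr ?exprn_gt0// (le_trans HX)//.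
by rewrite exprMn -/N mulrAC.
Qed.
End crossing_estimate.

(** * Decay of the crossing error *)

Section asymptotics.
Variables (R : realType) (d : nat).
Hypothesis d_gt0 : (0 < d)%N.
Local Notation n m := (sys_size d m).
Local Notation r m := (interaction_length R (sys_size d m)).
Local Notation rho m := ((r m)%:R / (n m - r m)%:R : R).

(** The bound of [crossing_bound] at n = [sys_size d m]. *)
Definition crossing_error (m : nat) : R :=
  (n m).+1%:R ^+ 3 * (1 - (2 * rho m / (1 + rho m) ^+ 2) ^+ 2) ^+ m.

(** All quantities are compared with the cube root [u] of n: the interaction length
    is about u^2/2, so that m (r/n)^2 is at least u/(16 d^2). *)
Let u m : R := (n m)%:R `^ (1 / 3).

Let u_ge0 m : 0 <= u m. Proof. exact: powR_ge0. Qed.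

Let u3 m : u m ^+ 3 = (n m)%:R.
Proof.
by rewrite -powR_mulrn// /u -powRrM (_ : 1 / 3 * 3%:R = 1) ?powRr1//; field.
Qed.

Let u2 m : (n m)%:R `^ (2 / 3) = u m ^+ 2.
Proof.
by rewrite -powR_mulrn// /u -powRrM (_ : 1 / 3 * 2%:R = 2 / 3)//; field.
Qed.

Let u_large (A : R) : \forall m \near \oo, A <= u m.
Proof.
near=> m; rewrite leNgt; apply/negP => uA.
have : (n m)%:R < A ^+ 3.
  by rewrite -u3 ltrXn2r// nnegrE// (le_trans (u_ge0 m))// ltW.
apply/negP; rewrite -leNgt; apply: (@le_trans _ _ m%:R).
  by near: m; exact: nbhs_infty_ger.
by rewrite ler_nat /sys_size leq_pmull// expn_gt0 d_gt0.
Unshelve. all: by end_near. Qed.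

Lemma interaction_length_itv m :
  u m ^+ 2 / 2 - 2 <= (r m)%:R <= u m ^+ 2 / 2.
Proof.
rewrite /interaction_length u2.
have /truncn_itv : 0 <= u m ^+ 2 / 4 by rewrite divr_ge0// sqr_ge0.
move: (Num.truncn _) => k; move: (u m ^+ 2) => x /andP[kx xk].
have {}xk : x / 4 < k%:R + 1 by rewrite natr1.
by rewrite natrM; lra.
Qed.

Lemma interaction_length_near :
  \forall m \near \oo, (0 < r m)%N /\ (4 * r m <= n m)%N.
Proof.
near=> m; have /andP[h1 h2] := interaction_length_itv m.
have u4 : 4 <= u m by near: m; exact: u_large.
split.
  by rewrite -(ltr_nat R); nra.
by rewrite -(ler_nat R) natrM -u3; nra.
Unshelve. all: by end_near. Qed.

(** The main factor is at most exp(-u/D) with D = 16 d^2, against (n+1)^3 <= 8 u^9.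
    The term of degree 10 of the exponential series beats u^9 by one power of u. *)
Lemma crossing_error_le : exists2 K : R, 0 <= K &
  \forall m \near \oo, 0 <= crossing_error m <= K / u m.
Proof.
pose D : R := 16 * d%:R ^+ 2.
have D0 : 0 < D by rewrite mulr_gt0// exprn_gt0// ltr0n.
exists (8 * 10`!%:R * D ^+ 10); first by rewrite !mulr_ge0// exprn_ge0// ltW.
near=> m.
have /andP[h1 h2] := interaction_length_itv m.
have u4 : 4 <= u m by near: m; exact: u_large.
have [r0 rn] : (0 < r m)%N /\ (4 * r m <= n m)%N.
  by near: m; exact: interaction_length_near.
rewrite /crossing_error.
have n0 : 0 < (n m)%:R :> R by rewrite ltr0n; lia.
have m0 : (0 < m)%N by move: n0; rewrite ltr0n /sys_size muln_gt0 => /andP[].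
have nE : (n m)%:R = d%:R ^+ 2 * m%:R :> R by rewrite /sys_size natrM natrX.
set q := 2 * rho m / _.
have qE : q = 2 * (r m)%:R * ((n m)%:R - (r m)%:R) / (n m)%:R ^+ 2.
  rewrite /q natrB; last by lia.
  have nr0 : (n m)%:R - (r m)%:R != 0 :> R.
    by rewrite subr_eq0 eqr_nat; apply/eqP; lia.
  by field; rewrite nr0 gt_eqF.
have rn' : 4 * (r m)%:R <= (n m)%:R :> R by rewrite -natrM ler_nat.
have r0' : 0 < (r m)%:R :> R by rewrite ltr0n.
have q_ge : (r m)%:R / (n m)%:R <= q.
  have -> : (r m)%:R / (n m)%:R = (r m)%:R * (n m)%:R / (n m)%:R ^+ 2 :> R.
    by field; rewrite gt_eqF.
  by rewrite qE ler_pM2r ?invr_gt0 ?exprn_gt0//; nra.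
have q_le1 : q <= 1.
  by rewrite qE ler_pdivrMr ?exprn_gt0//; nra.
have q0 : 0 <= q by apply: le_trans q_ge; rewrite divr_ge0// ltW.
have g0 : 0 <= 1 - q ^+ 2 by nra.
apply/andP; split; first by rewrite mulr_ge0 ?exprn_ge0.
pose y := u m / D.
have y0 : 0 <= y by rewrite divr_ge0// ltW.
have gy : (1 - q ^+ 2) ^+ m <= expR (- y).
  apply: (@le_trans _ _ (expR (- q ^+ 2) ^+ m)).
    by rewrite lerXn2r// ?nnegrE ?expR_ge0// expR_ge1Dx.
  rewrite -expRM_natl ler_expR mulrN lerN2 /y.
  apply: (@le_trans _ _ (m%:R * ((r m)%:R / (n m)%:R) ^+ 2)); last first.
    by rewrite ler_wpM2l// lerXn2r// nnegrE// divr_ge0// ltW.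
  have d0 : 0 < d%:R :> R by rewrite ltr0n.
  have -> : m%:R * ((r m)%:R / (n m)%:R) ^+ 2 = (r m)%:R ^+ 2 / (d%:R ^+ 2 * u m ^+ 3).
    have m0' : m%:R != 0 :> R by rewrite pnatr_eq0 -lt0n.
    by rewrite u3 nE; field; rewrite m0' gt_eqF.
  have rq : u m ^+ 2 / 4 <= (r m)%:R by nra.
  rewrite ler_pdivlMr; last by rewrite mulr_gt0// exprn_gt0//; lra.
  have -> : u m / D * (d%:R ^+ 2 * u m ^+ 3) = (u m ^+ 2 / 4) ^+ 2.
    by rewrite /D; field; rewrite gt_eqF.
  by rewrite lerXn2r ?nnegrE ?divr_ge0 ?sqr_ge0.
have ey : expR (- y) <= 10`!%:R / y ^+ 10.
  rewrite expRN ler_pdivlMr ?exprn_gt0 ?divr_gt0//; last by lra.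
  rewrite mulrC ler_pdivrMr ?expR_gt0//.
  have := expR_ge1Dxn 9 y0; set z := expR y => hz.
  rewrite mulrC -ler_pdivrMr ?ltr0n ?fact_gt0//.
  by rewrite (le_trans _ hz)// lerDr.
have n8 : (n m).+1%:R ^+ 3 <= 8 * u m ^+ 9.
  rewrite -natr1 -u3 (_ : 8 * u m ^+ 9 = (2 * u m ^+ 3) ^+ 3); last by ring.
  have u31 : 1 <= u m ^+ 3 by rewrite exprn_ege1//; lra.
  by rewrite lerXn2r ?nnegrE//; lra.
apply: (@le_trans _ _ (8 * u m ^+ 9 * (10`!%:R / y ^+ 10))).
  by rewrite ler_pM ?exprn_ge0// (le_trans gy).
rewrite le_eqVlt; apply/orP; left; apply/eqP.
rewrite /y; field.
by rewrite !gt_eqF//; lra.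
Unshelve. all: by end_near. Qed.

Lemma cvg_of_sqr_le_crossing_error (f : nat -> R) :
  (\forall m \near \oo, 0 <= f m /\ f m ^+ 2 <= crossing_error m) ->
  f m @[m --> \oo] --> (0 : R).
Proof.
move=> hf; have [K K0 hK] := crossing_error_le.
apply/cvgr0Pnorm_lt => e e0; near=> m.
have [f0 f2] : 0 <= f m /\ f m ^+ 2 <= crossing_error m by near: m.
have /andP[c0 c1] : 0 <= crossing_error m <= K / u m by near: m.
have uK : (K + 1) / e ^+ 2 <= u m by near: m; exact: u_large.
have u0 : 0 < u m by rewrite (lt_le_trans _ uK)// divr_gt0 ?exprn_gt0//; lra.
rewrite ger0_norm// -(ltr_pXn2r (ltn0Sn 1)) ?nnegrE ?(ltW e0)//.
rewrite (le_lt_trans (le_trans f2 c1))// ltr_pdivrMr//.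
move: uK; rewrite ler_pdivrMr ?exprn_gt0// mulrC; lra.
Unshelve. all: by end_near. Qed.
End asymptotics.

(** * The index sets of the model *)

Section index_sets.
Variables (R : realType) (d : nat) (Q : 'M[R]_d) (A2 : nat -> 'I_d -> {fset nat}).
Hypothesis Q_sym : forall i j : 'I_d, Q i j = Q j i.
Hypothesis Q_diag : forall i : 'I_d, Q i i = 0.
Hypothesis A2_choice : private_choice Q A2.
Implicit Types (i j k : 'I_d) (m x : nat).

(** The blocks are consecutive intervals of length m, numbered by [i * d + j]. *)
Lemma mem_block m i j x :
  (x \in block m i j) = ((i * d + j) * m < x <= (i * d + j).+1 * m)%N.
Proof. by rewrite inE/= mem_iota; apply/idP/idP; nia. Qed.

Lemma block_inj m i j i' j' x : x \in block m i j -> x \in block m i' j' ->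
  i = i' /\ j = j'.
Proof.
rewrite !mem_block => /andP[h1 h2] /andP[h3 h4].
have m0 : (0 < m)%N by case: m h1 h2 {h3 h4} => // ; rewrite !muln0; lia.
have e : (i * d + j = i' * d + j')%N by nia.
have hj := ltn_ord j; have hj' := ltn_ord j'.
have d0 : (0 < d)%N by apply: leq_ltn_trans hj.
have ej : j = j' :> nat.
  by have := congr1 (modn^~ d) e; rewrite !modnMDl !modn_small.
split; apply: val_inj => //=; move: e; rewrite ej => /addIn/eqP.
by rewrite eqn_pmul2r// => /eqP.
Qed.

Lemma block_le m i j x : x \in block m i j -> (0 < x <= sys_size d m)%N.
Proof.
rewrite mem_block /sys_size => /andP[h1 h2].
have hi := ltn_ord i; have hj := ltn_ord j.
apply/andP; split; first by lia.
apply: (leq_trans h2); rewrite leq_mul2r; apply/orP; right.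
by rewrite expnS expn1; nia.
Qed.

Lemma mem_shared m i x : reflect
  (exists2 j, Q i j = 0 & x \in block m i j \/ x \in block m j i)
  (x \in shared_indices Q m i).
Proof.
apply: (iffP (bigfcupP _ x _ _)) => [[j /andP[_ /eqP Qij]]|[j Qij xb]].
  by rewrite inE => /orP xb; exists j.
by exists j; rewrite ?mem_index_enum ?Qij ?eqxx// inE; apply/orP.
Qed.

Lemma shared_le m i x : x \in shared_indices Q m i -> (0 < x <= sys_size d m)%N.
Proof. by case/mem_shared => j _ [] /block_le. Qed.

(** Since blocks determine their indices, a common site lies in a block indexed by
    [i] and [j] together, which would give q_ij = 0, or forces i = j and q_ii = 0. *)
Lemma shared_disjoint m i j x : Q i j = 1 ->
  x \in shared_indices Q m i -> x \in shared_indices Q m j -> False.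
Proof.
move=> Q1.
have Qij : Q i j <> 0 by rewrite Q1; apply/eqP; exact: oner_neq0.
case/mem_shared => a Qa xa /mem_shared [b Qb xb].
case: xa xb => xa [] xb; have [] := block_inj xa xb => e1 e2; apply: Qij.
- by rewrite e1 Q_diag.
- by rewrite -e2.
- by rewrite Q_sym e2.
- by rewrite e2 Q_diag.
Qed.

Lemma private_itv m k x : (0 < m)%N -> x \in A2 m k ->
  (k.+1 * sys_size d m < x <= k.+2 * sys_size d m)%N.
Proof.
move=> m0 xA; have [/fsubsetP/(_ _ xA) + _] := A2_choice k m0.
by rewrite inE/= mem_iota; move: (sys_size d m) => n; nia.
Qed.

Lemma mem_model m k x :
  (x \in model_indices Q A2 m k) = (x \in shared_indices Q m k) || (x \in A2 m k).
Proof. by rewrite inE. Qed.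

Lemma model_gt0 m k x : (0 < m)%N -> x \in model_indices Q A2 m k -> (0 < x)%N.
Proof.
move=> m0; rewrite mem_model => /orP[/shared_le/andP[]//|/(private_itv m0)]; lia.
Qed.

Lemma model_disjoint m i j x : (0 < m)%N -> Q i j = 1 ->
  x \in model_indices Q A2 m i -> x \in model_indices Q A2 m j -> False.
Proof.
move=> m0 Q1; rewrite !mem_model.
have ij : (i : nat) <> j.
  by move=> /val_inj ij; move: Q1; rewrite ij Q_diag => /esym/eqP; rewrite oner_eq0.
move: (sys_size d m) (@shared_le m) (@private_itv m) => n shn pn.
move=> /orP[xi|/(pn _ _ m0) xi] /orP[xj|/(pn _ _ m0) xj].
- exact: shared_disjoint Q1 xi xj.
- by have := shn _ _ xi; nia.
- by have := shn _ _ xj; nia.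
- have [h|h] := ltnP i j; first by nia.
  have {}h : (j < i)%N by lia.
  by nia.
Qed.

Lemma card_model m k : (0 < m)%N -> #|` model_indices Q A2 m k| = sys_size d m.
Proof.
move=> m0; have [_ c2] := A2_choice k m0.
have sh_le : (#|` shared_indices Q m k| <= sys_size d m)%N.
  apply: (@leq_trans #|` [fset x in iota 1 (sys_size d m)]%fset|).
    apply: fsubset_leq_card; apply/fsubsetP => x /shared_le h.
    by rewrite inE/= mem_iota; lia.
  by rewrite card_fseq undup_id ?iota_uniq// size_iota.
have dis : (shared_indices Q m k `&` A2 m k = fset0)%fset.
  apply/fsetP => x; rewrite !inE; apply/negP => /andP[/shared_le h1 /(private_itv m0)].
  by move: h1; move: (sys_size d m) => n; nia.
have := cardfsUI (shared_indices Q m k) (A2 m k).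
by rewrite dis cardfs0 c2 /model_indices; lia.
Qed.

Definition sites m k : seq nat := sort leq (model_indices Q A2 m k).

Lemma mem_sites m k x : (x \in sites m k) = (x \in model_indices Q A2 m k).
Proof. by rewrite mem_sort. Qed.

Lemma sites_uniq m k : uniq (sites m k).
Proof. by rewrite sort_uniq fset_uniq. Qed.

Lemma sites_sorted m k : sorted ltn (sites m k).
Proof.
by rewrite ltn_sorted_uniq_leq sites_uniq sort_sorted//; exact: leq_total.
Qed.

Lemma size_sites m k : (0 < m)%N -> size (sites m k) = sys_size d m.
Proof. by move=> m0; rewrite size_sort card_model. Qed.

(** Both colours contain the block indexed by [i] and [j]. *)
Lemma sites_overlap m i j : Q i j = 0 ->
  (m <= count (mem (sites m j)) (sites m i))%N.
Proof.
move=> Qij.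
rewrite -[leqLHS](size_iota (i * (d * m) + j * m).+1) -size_filter.
apply: uniq_leq_size; first exact: iota_uniq.
move=> x xb; have {}xb : x \in block m i j by rewrite inE.
rewrite mem_filter /= !mem_sites !mem_model.
apply/andP; split; apply/orP; left; apply/mem_shared.
  by exists i; [rewrite Q_sym|right].
by exists j => //; left.
Qed.

(** A sublist of an increasing list is the same as an increasing tuple of its
    entries. *)
Lemma sum_sorted_tuples (V : nmodType) (F : seq nat -> V) r m k :
  \sum_(t : r.-tuple (model_indices Q A2 m k) | sorted ltn (map val t))
     F (map val t) =
  \sum_(t <- sublists_of_size r (sites m k)) F t.
Proof.
pose toseq (t : r.-tuple (model_indices Q A2 m k)) := map val t.
have toseqI : injective toseq.
  by move=> t u /(inj_map val_inj) tu; exact: val_inj.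
rewrite -(big_map toseq (fun t => sorted ltn t) F) -big_filter.
apply: perm_big; apply: uniq_perm.
- by rewrite filter_uniq// map_inj_uniq// index_enum_uniq.
- by rewrite filter_uniq// sublists_uniq// sites_uniq.
move=> t; rewrite mem_filter mem_sublists_of_size; apply/andP/andP => -[].
  move=> st /mapP[u _ tu]; split; last by rewrite tu size_map size_tuple.
  have -> : t = [seq x <- sites m k | x \in t].
    apply: (irr_sorted_eq ltn_trans ltnn st).
      by apply: sorted_filter; [exact: ltn_trans|exact: sites_sorted].
    move=> x; rewrite mem_filter mem_sites; apply/idP/andP => [xt|[]//].
    by split=> //; move: xt; rewrite tu => /mapP[y _ ->]; exact: valP.
  exact: filter_subseq.
move=> ts /eqP tr; split; first exact: subseq_sorted ltn_trans _ _ ts (sites_sorted m k).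
have tA x : x \in t -> x \in model_indices Q A2 m k.
  by move=> /(mem_subseq ts); rewrite mem_sites.
have /eqP ur : size (pmap (insub : nat -> option (model_indices Q A2 m k)) t) == r.
  rewrite size_pmap_sub -tr; apply/eqP/eqP; rewrite -all_count.
  by apply/allP => x /tA.
apply/mapP; exists (tcast ur (in_tuple (pmap insub t))).
  exact: mem_index_enum.
rewrite /toseq val_tcast/= pmap_filter; last by move=> x; exact: insubK.
by apply/esym/all_filterP/allP => x /tA xA; rewrite /= insubT.
Qed.
End index_sets.

(** * Expected traces *)

Section complex_expectation.
Variables (R : realType) (disp : measure_display) (T : measurableType disp).
Variables (P : probability T R) (U : eqType).
Implicit Types (l : seq U) (X : U -> T -> R).

Lemma Rintegral_linear_combination l X (c : U -> R) :
  {in l, forall u, P.-integrable [set: T] (EFin \o X u)} ->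
  P.-integrable [set: T] (fun w => (\sum_(u <- l) X u w * c u)%:E) /\
  fine (\int[P]_w (\sum_(u <- l) X u w * c u)%:E)%E =
  \sum_(u <- l) fine (\int[P]_w (X u w)%:E)%E * c u.
Proof.
elim: l => [_|u l IH Xl].
  split.
    by apply: eq_integrable (integrable0 _ _) => // w _; rewrite big_nil.
  by rewrite big_nil integral0_eq// => w _; rewrite big_nil.
have [] := IH; first by move=> v vl; apply: Xl; rewrite inE vl orbT.
set S := fun w => _ => iS eS.
have iu : P.-integrable [set: T] (EFin \o X u) by apply: Xl; rewrite mem_head.
have iuc : P.-integrable [set: T] (EFin \o (fun w => X u w * c u)).
  by apply: eq_integrable (integrableZr measurableT (c u) iu).
have E w : (\sum_(v <- u :: l) X v w * c v)%:E =
    ((X u w * c u)%:E + (\sum_(v <- l) X v w * c v)%:E)%E.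
  by rewrite big_cons EFinD.
split; first by apply: eq_integrable (integrableD measurableT iuc iS) => // w _.
rewrite big_cons -eS (eq_integral _ _ (fun w _ => E w)) integralD_EFin//.
rewrite fineD; try exact: integrable_fin_num.
congr (_ + _).
have -> : (\int[P]_w (X u w * c u)%:E = \int[P]_w ((X u w)%:E * (c u)%:E))%E.
  by apply: eq_integral => w _; rewrite EFinM.
rewrite integralZr// fineM//; exact: integrable_fin_num.
Qed.

Lemma complex_expectation_sum l X (z : U -> R[i]) (Z : T -> R[i]) :
  {in l, forall u, P.-integrable [set: T] (EFin \o X u)} ->
  (forall w, Z w = \sum_(u <- l) (X u w)%:C%C * z u) ->
  complex_integrable P Z /\
  complex_expectation P Z =
  \sum_(u <- l) (fine (\int[P]_w (X u w)%:E)%E)%:C%C * z u.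
Proof.
move=> iX ZE.
have ReZ w : complex.Re (Z w) = \sum_(u <- l) X u w * complex.Re (z u).
  rewrite ZE raddf_sum; apply: eq_bigr => u _.
  by case: (z u) => a b /=; rewrite mul0r subr0.
have ImZ w : complex.Im (Z w) = \sum_(u <- l) X u w * complex.Im (z u).
  rewrite ZE raddf_sum; apply: eq_bigr => u _.
  by case: (z u) => a b /=; rewrite mul0r addr0.
have [i1 e1] := Rintegral_linear_combination (fun u => complex.Re (z u)) iX.
have [i2 e2] := Rintegral_linear_combination (fun u => complex.Im (z u)) iX.
split.
  by split; [apply: eq_integrable i1 => // w _|apply: eq_integrable i2 => // w _];
    rewrite ?ReZ ?ImZ.
rewrite /complex_expectation expectation.unlock.
rewrite (eq_integral _ _ (fun w _ => congr1 EFin (ReZ w))) e1.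
rewrite (eq_integral _ _ (fun w _ => congr1 EFin (ImZ w))) e2.
apply/eqP; rewrite eq_complex !raddf_sum/=; apply/andP; split; apply/eqP;
  by apply: eq_bigr => u _; case: (z u) => a b /=; rewrite mul0r ?subr0 ?addr0.
Qed.
End complex_expectation.

Lemma cvg_real_complex (R : realType) (f : nat -> R) (l : R) :
  f m @[m --> \oo] --> l ->
  (f m)%:C%C @[m --> \oo] --> (l%:C%C : R[i]^o).
Proof.
move=> fl; apply/(@cvgrPdist_lt _ R[i]^o) => e e0.
have eE : e = (complex.Re e)%:C%C.
  by move: e0; case: e => a b; rewrite ltcE/= => /andP[/eqP -> _].
have e0' : 0 < complex.Re e by move: e0; rewrite ltcE => /andP[].
move/cvgrPdist_lt : fl => /(_ _ e0'); apply: filterS => m fm.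
by rewrite eE -rmorphB/= normc_def/= expr0n addr0 sqrtr_sqr ltcR.
Qed.

Section model.
Variables (R : realType) (d : nat) (Q : 'M[R]_d)
  (A : algType R[i]) (star : A -> A) (psi : nat -> A) (tr : A -> R[i])
  (disp : measure_display) (T : measurableType disp) (P : probability T R)
  (J : 'I_d -> seq nat -> {RV P >-> R}) (A2 : nat -> 'I_d -> {fset nat}).
Hypotheses (d_gt0 : (0 < d)%N)
  (Q_sym : forall i j : 'I_d, Q i j = Q j i)
  (Q_offdiag : forall i j : 'I_d, i != j -> Q i j = 0 \/ Q i j = 1)
  (Q_diag : forall i : 'I_d, Q i i = 0)
  (psi_majorana : majorana_fermions star psi)
  (tr_trace : normalized_trace psi tr)
  (A2_choice : private_choice Q A2)
  (J_indep : mutually_independent (@coupling_index d)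
               (fun kt : 'I_d * seq nat => J kt.1 kt.2))
  (J_gauss : forall kt : 'I_d * seq nat, coupling_index kt ->
               standard_gaussian (J kt.1 kt.2)).

Local Notation n m := (sys_size d m).
Local Notation r m := (interaction_length R (sys_size d m)).
Local Notation label := ('I_d * seq nat)%type.
Implicit Types (k : 'I_d) (c : seq 'I_d) (a : seq label) (x y : label).

Definition labels m k := sublists_of_size (r m) (sites Q A2 m k).
Definition label_sign x y : R := exchange_sign R x.2 y.2.
Definition normalization m : R := (Num.sqrt 'C(n m, r m)%:R)^-1.
(** The power of the imaginary unit makes the square of the monomial equal
    to 1. *)
Definition monomial m x : A := 'i ^+ (r m)./2 *: fermion_word psi x.2.

Local Notation coupling := (fun k t => J k t : T -> R).
Local Notation H m k w := (SYK_hamiltonian Q psi coupling A2 m k w).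

Lemma hamiltonianE m k w : H m k w =
  \sum_(t <- labels m k) (normalization m * J k t w)%:C%C *: monomial m (k, t).
Proof.
rewrite /SYK_hamiltonian.
rewrite (sum_sorted_tuples Q A2 (fun t => (J k t w)%:C%C *: \prod_(i <- t) psi i)).
rewrite scaler_sumr; apply: eq_bigr => t _.
rewrite /monomial /normalization !scalerA rmorphM fmorphV; congr (_ *: _).
by rewrite [RHS]mulrC mulrA.
Qed.

Definition coupling_product a (w : T) : R := \prod_(x <- a) J x.1 x.2 w.

Lemma prod_hamiltonianE m c w : \prod_(k <- rev c) H m k w =
  \sum_(a <- coloured_words (labels m) c)
    (normalization m ^+ size c * coupling_product a w)%:C%C *:
    \prod_(x <- rev a) monomial m x.
Proof.
rewrite (eq_bigr _ (fun k _ => hamiltonianE m k w)).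
rewrite (prod_sum_coloured_words (labels m)
  (fun x => (normalization m * J x.1 x.2 w)%:C%C *: monomial m x)).
rewrite big_seq [RHS]big_seq; apply: eq_bigr => a ac.
have -> : normalization m ^+ size c * coupling_product a w =
    \prod_(x <- rev a) (normalization m * J x.1 x.2 w).
  rewrite big_split/= big_const_seq count_predT size_rev (size_coloured_words ac).
  by rewrite iter_mulr_1 /coupling_product (perm_big _ (permEl (perm_rev a))).
elim: (rev a) => [|x b IH]; first by rewrite !big_nil scale1r.
by rewrite !big_cons IH -scalerAl -scalerAr scalerA [in RHS]rmorphM.
Qed.

Lemma label_size m k t : t \in labels m k -> size t = r m.
Proof. by rewrite mem_sublists_of_size => /andP[_ /eqP]. Qed.

Lemma label_uniq m k t : t \in labels m k -> uniq t.
Proof.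
rewrite mem_sublists_of_size => /andP[/subseq_uniq + _]; apply; exact: sites_uniq.
Qed.

Lemma label_sub m k t : t \in labels m k -> {subset t <= model_indices Q A2 m k}.
Proof.
by rewrite mem_sublists_of_size => /andP[/mem_subseq ts _] x /ts; rewrite mem_sites.
Qed.

Lemma label_gt0 m k t : (0 < m)%N -> t \in labels m k -> all (ltn 0) t.
Proof. by move=> m0 tL; apply/allP => x /(label_sub tL)/(model_gt0 A2_choice m0). Qed.

Lemma label_coupling_index m k t : (0 < m)%N -> t \in labels m k ->
  coupling_index (k, t).
Proof.
move=> m0 tL; rewrite /coupling_index/= path_sortedE; last exact: ltn_trans.
rewrite (label_gt0 m0 tL)/=; move: tL; rewrite mem_sublists_of_size => /andP[ts _].
exact: subseq_sorted ltn_trans _ _ ts (sites_sorted Q A2 m k).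
Qed.

Lemma half_interaction_length m : (r m)./2.*2 = r m.
Proof. by rewrite /interaction_length mul2n doubleK. Qed.

Lemma monomial_sqr m x : (0 < m)%N -> x.2 \in labels m x.1 ->
  monomial m x * monomial m x = 1.
Proof.
move=> m0 xL; rewrite /monomial -scalerAl -scalerAr scalerA.
rewrite (fermion_word_sqr psi_majorana (label_gt0 m0 xL) (label_uniq xL)).
rewrite scalerA (label_size xL) -{3}half_interaction_length sign_bin2.
rewrite -exprD addnn -mul2n exprM -exprMn.
by rewrite sqrCi mulrNN mulr1 expr1n scale1r.
Qed.

Lemma monomial_comm m x y : (0 < m)%N ->
  x.2 \in labels m x.1 -> y.2 \in labels m y.1 ->
  monomial m x * monomial m y =
  (label_sign x y)%:C%C *: (monomial m y * monomial m x).
Proof.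
move=> m0 xL yL; rewrite /monomial -!scalerAl -!scalerAr !scalerA.
rewrite (fermion_word_comm psi_majorana (label_gt0 m0 xL) (label_gt0 m0 yL)); last first.
  by rewrite (label_size yL) -half_interaction_length odd_double.
rewrite scalerA; congr (_ *: _); rewrite mulrC mulrA; congr (_ * _ * _).
rewrite rmorph_prod; apply: eq_bigr => i _.
by rewrite count_uniq_mem ?(label_uniq yL)// rmorphXn rmorphN1.
Qed.

Lemma monomial_majorana m x : (0 < m)%N -> x.2 \in labels m x.1 ->
  majorana_algebra psi (monomial m x).
Proof.
move=> m0 xL; apply: majorana_algebraZ; apply: majorana_fermion_word.
exact: label_gt0 m0 xL.
Qed.

(** If the letters of [a] can be contracted completely, their product in the algebra
    is a sign and so is its trace; otherwise both sides vanish. *)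
Lemma amplitude_trace m a : (0 < m)%N -> all (fun y => y.2 \in labels m y.1) a ->
  (amplitude (fun _ _ => 1 : R) a [::])%:C%C * tr (\prod_(x <- rev a) monomial m x) =
  (amplitude label_sign a [::])%:C%C.
Proof.
move=> m0 aL; pose G := [pred x : label | x.2 \in labels m x.1].
have := @amplitude_word _ _ _ (monomial m) G (fun x y => (label_sign x y)%:C%C)
  (fun x y xG yG => monomial_comm m0 xG yG) (fun x xG => monomial_sqr m0 xG)
  a [::] aL isT.
rewrite big_nil mulr1 => /(congr1 tr).
rewrite !(trace_scale tr_trace); first last.
- apply: majorana_algebra_prod => x; rewrite mem_rev => xa.
  by apply: monomial_majorana => //; exact: (allP aL).
- exact: majorana_one.
rewrite (trace_one tr_trace) mulr1 -[in RHS](rmorph_amplitude (real_complex R)) => <-.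
congr (_ * _); rewrite (rmorph_amplitude (real_complex R)).
by apply: eq_amplitude => x y; rewrite rmorph1.
Qed.

Lemma expectation_coupling_product m c a : (0 < m)%N ->
  a \in coloured_words (labels m) c ->
  P.-integrable [set: T] (EFin \o coupling_product a) /\
  fine (\int[P]_w (coupling_product a w)%:E)%E = amplitude (fun _ _ => 1) a [::].
Proof.
move=> m0 ac.
have aD : forall x, x \in a -> @coupling_index d x.
  move=> [k t] xa; apply: (label_coupling_index m0).
  exact: (allP (mem_coloured_words ac) _ xa).
have [i e] := expectation_prod J_indep J_gauss aD.
split; first exact: i.
rewrite e /=; apply: (wick_moments (g := @gaussian_mean R : {linear _ -> R^o})).
- exact: gaussian_mean_by_parts.
- exact: gaussian_mean1.
Qed.

(** The expected trace is an exact finite-size analogue of the vacuum moment. *)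
Lemma mean_trace m c : (0 < m)%N ->
  let Z w := tr (\prod_(k <- rev c) H m k w) in
  complex_integrable P Z /\
  complex_expectation P Z = (mean_amplitude (labels m) label_sign c [::])%:C%C.
Proof.
move=> m0 Z; set W := coloured_words (labels m) c.
have WL a : a \in W -> all (fun y => y.2 \in labels m y.1) a.
  exact: mem_coloured_words.
have WM a : a \in W -> majorana_algebra psi (\prod_(x <- rev a) monomial m x).
  move=> aW; apply: majorana_algebra_prod => x; rewrite mem_rev => xa.
  by apply: monomial_majorana => //; exact: (allP (WL a aW)).
have ZE w : Z w = \sum_(a <- W) (coupling_product a w)%:C%C *
    ((normalization m ^+ size c)%:C%C * tr (\prod_(x <- rev a) monomial m x)).
  rewrite /Z prod_hamiltonianE (trace_sum tr_trace)//; apply: eq_bigr => a _.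
  by rewrite rmorphM mulrAC mulrA mulrC mulrA.
have iW : {in W, forall a, P.-integrable [set: T] (EFin \o coupling_product a)}.
  by move=> a aW; have [] := expectation_coupling_product m0 aW.
have [iZ ->] := complex_expectation_sum iW ZE; split=> //.
transitivity ((\sum_(a <- W) amplitude label_sign a [::]) * normalization m ^+ size c)%:C%C.
  rewrite [RHS]rmorphM [in RHS]rmorph_sum mulr_suml big_seq [RHS]big_seq.
  apply: eq_bigr => a aW; have [_ ->] := expectation_coupling_product m0 aW.
  rewrite [X in _ = X * _](_ : _ = (amplitude label_sign a [::])%:C%C)//.
  by rewrite -(amplitude_trace m0 (WL a aW)) mulrCA mulrC.
congr (_%:C%C).
rewrite (sum_amplitude_coloured_words (N := 'C(n m, r m)))//.
- by rewrite expr0 mul1r.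
- by move=> k; rewrite size_sublists_of_size size_sites.
- by move=> k; rewrite filter_uniq// sublists_uniq// sites_uniq.
- by rewrite /normalization exprVn sqr_sqrtr.
Qed.

Lemma label_sign_le1 x y : `|label_sign x y| <= 1.
Proof. by rewrite norm_exchange_sign. Qed.

Lemma mean_amplitude_limit c :
  mean_amplitude (labels m) label_sign c [::] @[m --> \oo] --> amplitude Q c [::].
Proof.
apply: (@mean_amplitude_cvg R 'I_d (seq nat) labels label_sign Q label_sign_le1 _ _ _ _
  c [::]).
- move=> i j; have [->|] := eqVneq i j; first by left; exact: Q_diag.
  exact: Q_offdiag.
- near=> m => i.
  have m0 : (0 < m)%N by near: m; exact: nbhs_infty_gt.
  have [r0 rn] : (0 < r m)%N /\ (4 * r m <= n m)%N.
    by near: m; exact: interaction_length_near.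
  apply: (sublists_of_size_neq0 (n := n m)) => // k; exact: size_sites.
- near=> m => i j t u Qij tL uL.
  have m0 : (0 < m)%N by near: m; exact: nbhs_infty_gt.
  apply: exchange_sign_disjoint; apply/hasPn => x xt /=; apply/negP => xu.
  exact: (model_disjoint Q_sym Q_diag A2_choice m0 Qij (label_sub tL xt) (label_sub uL xu)).
move=> i c' /hasP[j jc /eqP Qij].
apply: (cvg_of_sqr_le_crossing_error d_gt0); near=> m.
have m0 : (0 < m)%N by near: m; exact: nbhs_infty_gt.
have [r0 rn] : (0 < r m)%N /\ (4 * r m <= n m)%N.
  by near: m; exact: interaction_length_near.
split.
  rewrite -(word_average0 R (labels m) c'); apply: le_word_average => v _.
  exact: normr_ge0.
apply: (@crossing_bound R 'I_d nat (sites Q A2 m) (n m) (r m) _ _ r0 rn i j) => //.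
- by move=> k; exact: sites_uniq.
- by move=> k; exact: size_sites.
- exact: sites_overlap.
Unshelve. all: by end_near. Qed.
End model.

Theorem mainTheorem4 (R : realType) (d : nat) (Q : 'M[R]_d)
    (A : algType R[i]) (star : A -> A) (psi : nat -> A) (tr : A -> R[i])
    (disp : measure_display) (T : measurableType disp) (P : probability T R)
    (J : 'I_d -> seq nat -> {RV P >-> R}) (A2 : nat -> 'I_d -> {fset nat})
    (d_gt0 : (0 < d)%N)
    (Q_sym : forall i j : 'I_d, Q i j = Q j i)
    (Q_offdiag : forall i j : 'I_d, i != j -> Q i j = 0 \/ Q i j = 1)
    (Q_diag : forall i : 'I_d, Q i i = 0)
    (star_op : star_operation star)
    (psi_majorana : majorana_fermions star psi)
    (tr_trace : normalized_trace psi tr)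
    (A2_choice : private_choice Q A2)
    (J_indep : mutually_independent (@coupling_index d)
                 (fun kt : 'I_d * seq nat => J kt.1 kt.2))
    (J_gauss : forall kt : 'I_d * seq nat, coupling_index kt ->
                 standard_gaussian (J kt.1 kt.2)) :
  let H (m : nat) (k : 'I_d) (w : T) : A :=
    SYK_hamiltonian Q psi (fun k t => J k t : T -> R) A2 m k w in
  forall (p : nat) (p_gt0 : (0 < p)%N) (ks : p.-tuple 'I_d),
    (forall m : nat, (0 < m)%N ->
       complex_integrable P (fun w => tr (\prod_(k <- ks) H m k w))) /\
    complex_expectation P (fun w => tr (\prod_(k <- ks) H m k w)) @[m --> \oo]
      --> (vacuum_state Q (operator_product [seq q_gaussian Q k | k <- ks])
             : R[i]^o).
Proof.
move=> H p p_gt0 ks; rewrite -[tval ks]revK; split.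
  move=> m m0.
  by have [] := mean_trace psi_majorana tr_trace A2_choice J_indep J_gauss (rev ks) m0.
rewrite vacuum_state_amplitude (revK (rev ks)).
have hc := cvg_real_complex (mean_amplitude_limit d_gt0 Q_sym Q_offdiag
  Q_diag A2_choice (c := rev ks)).
apply: cvg_trans hc.
apply: near_eq_cvg; near=> m.
have m0 : (0 < m)%N by near: m; exact: nbhs_infty_gt.
by have [_ ->] := mean_trace psi_majorana tr_trace A2_choice J_indep J_gauss (rev ks) m0.
Unshelve. all: by end_near. Qed.
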